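(* Let $X$ be a compact Hausdorff space whose topology has a countable basis, and let $L:\mathscr{P}^{(2)}\to\mathbb{R}$ be linear and $\mathcal{N}(X)$-positive. Then the following are equivalent: (a) there exists an $\mathcal{N}(X)$-representing measure for $L$ with finite third moment; (b) there exists $R>0$ such that for all $f_0,f_3\in\mathbb{R}$, $f_1\in\mathcal{C}_c(X)$, $f_2\in\mathcal{C}_c(X^2)$ for which the restricted cubic polynomial $$q_{f_0,f_1,f_2,f_3}(\eta)=f_0+f_1\eta+f_2\eta^{\otimes 2}+f_3\,1_X^{\otimes 3}\eta^{\otimes 3}$$ satisfies $q_{f_0,f_1,f_2,f_3}(\eta)\ge 0$ for all $\eta\in\mathcal{N}(X)$, one has $$L(f_0+f_1\eta+f_2\eta^{\otimes 2})+f_3R\ \geq\ 0.$$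
   Context: $\mathcal{C}_c(X^n)$ is the space of continuous real-valued compactly supported functions on $X^n$. $\mathcal{M}(X)$ is the vector space of all signed Radon measures on $X$, endowed with the vague topology, i.e. the weakest topology such that $\nu\mapsto\int_X f\,d\nu$ is continuous for every $f\in\mathcal{C}_c(X)$. $\mathcal{N}(X)\subseteq\mathcal{M}(X)$ is the (closed) point configuration space: the set of all Radon measures on $X$ taking as values non-negative integers or infinity, i.e. measures $\eta=\sum_{i\in I}\delta_{x_i}$ with $x_i\in X$, $I$ either $\mathbb{N}$ or a finite (possibly empty) subset of $\mathbb{N}$, and, if $I=\mathbb{N}$, $(x_i)_{i\in I}$ without accumulation points in $X$ (so every compact set contains finitely many of the $x_i$, counted with multiplicity). For $n\in\mathbb{N}$ and $\eta\in\mathcal{M}(X)$, $\eta^{\otimes n}(dx_1,\ldots,dx_n)=\eta(dx_1)\cdots\eta(dx_n)$ is the $n$-fold product measure on $X^n$, and for a function $f_n$ on $X^n$ one writes $f_n\eta^{\otimes n}:=\int_{X^n}f_n\,d\eta^{\otimes n}$. $1_X^{\otimes 3}$ is the constant function $1$ on $X^3$, so $1_X^{\otimes 3}\eta^{\otimes 3}=\eta(X)^3$. $\mathscr{P}^{(2)}$ is the real vector space of all functions on $\mathcal{M}(X)$ of the form $\eta\mapsto f_0+f_1\eta+f_2\eta^{\otimes 2}$ with $f_0\in\mathbb{R}$, $f_1\in\mathcal{C}_c(X)$, $f_2\in\mathcal{C}_c(X^2)$. $L$ is $\mathcal{N}(X)$-positive if $L(b)\ge 0$ for every $b\in\mathscr{P}^{(2)}$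 with $b(\eta)\ge 0$ for all $\eta\in\mathcal{N}(X)$. An $\mathcal{N}(X)$-representing measure for $L$ is a non-negative Radon measure $\nu$ on $\mathcal{M}(X)$ supported in $\mathcal{N}(X)$ such that every $b\in\mathscr{P}^{(2)}$ is $\nu$-integrable and $L(b)=\int_{\mathcal{N}(X)}b(\eta)\,\nu(d\eta)$ for all $b\in\mathscr{P}^{(2)}$. Such a $\nu$ has finite third moment if $\int_{\mathcal{N}(X)}1_X^{\otimes 3}\eta^{\otimes 3}\,\nu(d\eta)<\infty$. *)

(* Defs.v *)
From HB Require Import structures.
From mathcomp Require Import all_boot all_order all_algebra.
From mathcomp Require Import all_classical all_reals all_analysis.

Set Implicit Arguments.
Unset Strict Implicit.
Unset Printing Implicit Defensive.

Import Order.TTheory GRing.Theory Num.Theory.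
Import numFieldNormedType.Exports.

Local Open Scope classical_set_scope.
Local Open Scope ring_scope.

(* Borel sigma-algebra.  This alias carries the measurable structure only; the
   topology is still found on T itself, to which [borel T] is convertible. *)
Notation borel T := (g_sigma_algebraType (@open T)).

(* Radon measures on a Hausdorff space: locally finite Borel measures that are
   inner regular with respect to the compact sets (compact sets are closed,
   hence Borel, when T is Hausdorff). *)
Definition radon (R : realType) (T : ptopologicalType)
    (mu : set (borel T) -> \bar R) : Prop :=
  (forall x : T, exists U : set T, [/\ open U, U x & (mu U < +oo)%E]) /\
  (forall A : set (borel T), measurable A ->
     mu A = ereal_sup
       [set mu K | K in [set K : set T | compact K /\ K `<=` A]]).

Definition Cc (R : realType) (T : topologicalType) : set (T -> R) :=
  [set f | continuous f /\ compact (closure [set x | f x != 0])].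
Arguments Cc : clear implicits.

Section charge_integral.
Context (R : realType) d (T : measurableType d).
Variable nu : {charge set T -> \bar R}.

Definition hahn_pos : set T := sval (cid (Hahn_decomposition nu)).
Definition hahn_neg : set T :=
  sval (cid (svalP (cid (Hahn_decomposition nu)))).

Lemma hahn_posneg : hahn_decomposition nu hahn_pos hahn_neg.
Proof. exact: svalP (cid (svalP (cid (Hahn_decomposition nu)))). Qed.

(* The Jordan parts do not depend on the Hahn decomposition that is chosen. *)
Definition cpos : {finite_measure set T -> \bar R} := jordan_pos hahn_posneg.
Definition cneg : {finite_measure set T -> \bar R} := jordan_neg hahn_posneg.

Definition charge_integral (f : T -> R) : R :=
  \int[cpos]_x f x - \int[cneg]_x f x.

End charge_integral.

Section finite_product.
Context (R : realType) d1 d2 (T1 : measurableType d1) (T2 : measurableType d2).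
Variables (m1 : {finite_measure set T1 -> \bar R})
          (m2 : {finite_measure set T2 -> \bar R}).

Definition finite_product : set (T1 * T2)%type -> \bar R := (m1 \x m2)%E.

HB.instance Definition _ := Measure.on finite_product.

Let finite_product_fin : fin_num_fun finite_product.
Proof.
apply: lty_fin_num_fun.
rewrite -setXTT [X in (X < _)%E]product_measure1E//.
by rewrite lte_mul_pinfty ?fin_num_measure// -ge0_fin_numE// fin_num_measure.
Qed.

HB.instance Definition _ :=
  @Measure_isFinite.Build _ _ _ finite_product finite_product_fin.

End finite_product.

(* Product of two charges, by bilinearity from their Jordan parts:
   (p1 - n1) (x) (p2 - n2) = p1 (x) p2 + n1 (x) n2 - (p1 (x) n2 + n1 (x) p2) *)
Definition charge_product (R : realType) d1 d2
    (T1 : measurableType d1) (T2 : measurableType d2)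
    (nu1 : {charge set T1 -> \bar R}) (nu2 : {charge set T2 -> \bar R}) :
    {charge set (T1 * T2)%type -> \bar R} :=
  let pos := cadd
    (charge_of_finite_measure (finite_product (cpos nu1) (cpos nu2)))
    (charge_of_finite_measure (finite_product (cneg nu1) (cneg nu2))) in
  let neg := cadd
    (charge_of_finite_measure (finite_product (cpos nu1) (cneg nu2)))
    (charge_of_finite_measure (finite_product (cneg nu1) (cpos nu2))) in
  cadd pos (copp neg).

(* The space M(X) of signed Radon measures on a compact space X: all Radon
   measures are finite, so the signed ones are the real-valued charges that are
   differences of two Radon measures.  A charge of the library is a function on
   all subsets, with arbitrary values outside the sigma-algebra; [srm_out]
   normalises these, so that two elements of [srm] which agree on Borel sets
   are equal (otherwise the vague topology would not be Hausdorff). *)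
Record srm (R : realType) (X : ptopologicalType) := SRM {
  srm_charge :> {charge set (borel X) -> \bar R};
  srm_radon : exists mu1 mu2 : {finite_measure set (borel X) -> \bar R},
    [/\ radon mu1, radon mu2 & forall A, measurable A ->
        srm_charge A = (mu1 A - mu2 A)%E];
  srm_out : forall A, ~ measurable A -> srm_charge A = 0%E }.

Lemma srm_eq (R : realType) (X : ptopologicalType) (eta1 eta2 : srm R X) :
  (forall A : set (borel X), measurable A -> eta1 A = eta2 A) -> eta1 = eta2.
Proof.
case: eta1 eta2 => [c1 r1 o1] [c2 r2 o2] /= c12.
have cE : c1 = c2 :> (set (borel X) -> \bar R).
  apply/funext => A; have [mA|nmA] := pselect (measurable A).
    exact: c12.
  by rewrite o1// o2.
have {}cE : c1 = c2.
  case: c1 c2 {r1 o1 r2 o2 c12} cE => [f1 [[a1] [b1] [e1]]] [f2 [[a2] [b2] [e2]]].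
  move=> /= f12; case: _ / f12 in a2 b2 e2 *.
  rewrite (Prop_irrelevance a1 a2) (Prop_irrelevance b1 b2).
  by rewrite (Prop_irrelevance e1 e2).
case: _ / cE in r2 o2 *.
by congr SRM; exact: Prop_irrelevance.
Qed.

Lemma radon_mzero (R : realType) (T : ptopologicalType) :
  radon (mzero : set (borel T) -> \bar R).
Proof.
split=> [x|A _]; first by exists setT; split; [exact: openT|by []|by rewrite /mzero].
apply/eqP; rewrite eq_le; apply/andP; split.
  by apply: ereal_sup_ubound; exists set0 => //; split=> //; exact: compact0.
by apply: ge_ereal_sup => _ [K _ <-].
Qed.

Lemma srm0_radon (R : realType) (X : ptopologicalType) :
  exists mu1 mu2 : {finite_measure set (borel X) -> \bar R},
    [/\ radon mu1, radon mu2 & forall A : set (borel X), measurable A ->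
        (czero A : \bar R) = (mu1 A - mu2 A)%E].
Proof.
exists mzero, mzero; split; [exact: radon_mzero|exact: radon_mzero|].
by move=> A _; rewrite /mzero/= sube0.
Qed.

Definition srm0 (R : realType) (X : ptopologicalType) : srm R X :=
  @SRM R X czero (srm0_radon R X) (fun _ _ => erefl).

HB.instance Definition _ (R : realType) (X : ptopologicalType) :=
  gen_eqMixin (srm R X).
HB.instance Definition _ (R : realType) (X : ptopologicalType) :=
  gen_choiceMixin (srm R X).
HB.instance Definition _ (R : realType) (X : ptopologicalType) :=
  isPointed.Build (srm R X) (srm0 R X).

(* Vague topology: the supremum of the initial topologies of the maps
   eta |-> \int f d(eta), for f continuous with compact support. *)
Definition vague_topology (R : realType) (X : ptopologicalType) : Type :=
  sup_topology (fun f : Cc R X => Topological.on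
    (initial_topology (fun eta : srm R X => charge_integral eta (\val f)))).
HB.instance Definition _ (R : realType) (X : ptopologicalType) :=
  Topological.on (vague_topology R X).
HB.instance Definition _ (R : realType) (X : ptopologicalType) :=
  Topological.copy (srm R X) (vague_topology R X).

(* The value +oo is not reached since X is compact in what follows. *)
Definition point_config (R : realType) (X : ptopologicalType) :
    set (srm R X) :=
  [set eta | forall A : set (borel X), measurable A ->
     exists k : nat, eta A = (k%:R)%:E].
Arguments point_config : clear implicits.

Section polynomials.
Context (R : realType) (X : ptopologicalType).

Definition pair1 (f1 : X -> R) (eta : srm R X) : R := charge_integral eta f1.

Definition pair2 (f2 : X * X -> R) (eta : srm R X) : R :=
  charge_integral (charge_product eta eta) f2.

Definition pair3 (f3 : X * X * X -> R) (eta : srm R X) : R :=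
  charge_integral (charge_product (charge_product eta eta) eta) f3.

Definition quadratic (f0 : R) (f1 : X -> R) (f2 : X * X -> R)
    (eta : srm R X) : R :=
  f0 + pair1 f1 eta + pair2 f2 eta.

Definition restricted_cubic (f0 : R) (f1 : X -> R) (f2 : X * X -> R) (f3 : R)
    (eta : srm R X) : R :=
  f0 + pair1 f1 eta + pair2 f2 eta + f3 * pair3 (cst 1) eta.

Definition P2 : set (srm R X -> R) :=
  [set b | exists (f0 : R) (f1 : Cc R X) (f2 : Cc R (X * X)%type),
     b = quadratic f0 (\val f1) (\val f2)].

Lemma quadratic_in_P2 (f0 : R) (f1 : Cc R X) (f2 : Cc R (X * X)%type) :
  quadratic f0 (\val f1) (\val f2) \in P2.
Proof. by rewrite inE; exists f0, f1, f2. Qed.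

Definition P2_quadratic (f0 : R) (f1 : Cc R X) (f2 : Cc R (X * X)%type) : P2 :=
  exist _ (quadratic f0 (\val f1) (\val f2)) (quadratic_in_P2 f0 f1 f2).

(* Linearity on the vector space P2 of functions, whose operations are the
   pointwise ones. *)
Definition P2_linear (L : P2 -> R) : Prop :=
  forall (c : R) (b1 b2 b3 : P2),
    \val b3 = c *: \val b1 + \val b2 -> L b3 = c * L b1 + L b2.

Definition config_positive (L : P2 -> R) : Prop :=
  forall b : P2, (forall eta, point_config R X eta -> 0 <= \val b eta) -> 0 <= L b.

Definition representing_measure (L : P2 -> R)
    (nu : {measure set (borel (srm R X)) -> \bar R}) : Prop :=
  [/\ radon nu,
      nu (~` point_config R X) = 0%E,
      forall b : P2, nu.-integrable [set: borel (srm R X)] (EFin \o \val b) &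
      forall b : P2,
        (L b)%:E = (\int[nu]_(eta in point_config R X) (\val b eta)%:E)%E].

Definition finite_third_moment
    (nu : {measure set (borel (srm R X)) -> \bar R}) : Prop :=
  (\int[nu]_(eta in point_config R X) (pair3 (cst 1) eta)%:E < +oo)%E.

End polynomials.
Arguments P2 : clear implicits.

(* Main.v *)
Require Import Defs.
From HB Require Import structures.
From mathcomp Require Import all_boot all_order all_algebra.
From mathcomp Require Import all_classical all_reals all_analysis.
From mathcomp Require Import measurable_realfun.
From mathcomp Require Import ring lra.

Set Implicit Arguments.
Unset Strict Implicit.
Unset Printing Implicit Defensive.

Import Order.TTheory GRing.Theory Num.Theory.
Import numFieldNormedType.Exports.

Local Open Scope classical_set_scope.
Local Open Scope ring_scope.

(** A compact metrizable space [X] is a continuous image of the Cantor space K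
    = 2^nat, so that (k, c) |-> delta_(x_0) + .. + delta_(x_(k-1)), with the
    points x_i read off c, is a continuous map T from [nat * K] onto the point
    configurations.  Condition (b) says that q |-> L (quadratic part) + f3 r is
    positive on the restricted cubic polynomials; Hahn-Banach extends it to a
    positive functional Lam on ALL functions on [nat * K], continuous or not,
    of growth at most [1 + k ^ 3].  Then A |-> Lam (1_A) is a finitely additive
    measure on the compact open sets, where compactness makes it countably
    additive.  Its Caratheodory extension, pushed forward by T, represents L:
    no mass of a quadratic polynomial is lost at infinity because [1 + k ^ 3]
    dominates it.

    Conversely (a) gives (b) with r the third moment plus one, as a nonnegative
    restricted cubic polynomial has a nonnegative leading coefficient. *)

(** * Hahn-Banach *)

(** The extension goes to all functions, not to a space of continuous ones, so that it can be
    evaluated on indicators and the measure can be read off directly. The price is that [Lam] is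
    only finitely additive and may put mass at infinity: for a nonnegative continuous function the
    integral is in general only bounded by the value of [Lam]. Equality needs a tail estimate, which
    quadratic growth satisfies and the cubic weight itself need not. This is why the cubic
    coefficient yields finiteness of the third moment but not its value.

    The codes are needed because the method lives on compact open sets, and the vector space of
    measures has none to offer. On the codes they form a ring, and a countable base of them
    generates the Borel sets. Going back is harmless: continuous images of compact sets are compact,
    so inner regularity survives the push-forward.

    A second obstacle is the quadratic term. Product charges live on a product of Borel
    sigma-algebras, while the vague topology controls only integrals of functions of one variable.
    Uniform approximation by tensor sums links the two. *)

Section hahn_banach.
Context (R : realType) (V : lmodType R) (E : set V).
Hypothesis E0 : E 0.
Hypothesis ED : forall x y, E x -> E y -> E (x + y).
Hypothesis EZ : forall a x, E x -> E (a *: x).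

(** Everything is relative to a subspace [E], because a functional is wanted only on the dominated
    functions inside the module of all functions. The inequality for positive scalars is an equality
    in disguise, as applying it to [a^-1] shows. *)
Definition sublinear_on (p : V -> R) :=
  (forall x y, E x -> E y -> p (x + y) <= p x + p y) /\
  (forall a x, 0 < a -> E x -> p (a *: x) <= a * p x).

Let EN x : E x -> E (- x).
Proof. by rewrite -scaleN1r; exact: EZ. Qed.

Let sublinear0 p : sublinear_on p -> p 0 = 0.
Proof.
move=> [_ pZ]; have := pZ 2 0 (ltr0n _ 2) E0; have := pZ 2^-1 0.
rewrite !scaler0 invr_gt0 ltr0n => /(_ erefl E0).
by move=> ? ?; apply/eqP; rewrite eq_le; apply/andP; split; lra.
Qed.

Let sublinearN p x : sublinear_on p -> E x -> - p (- x) <= p x.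
Proof.
move=> ps Ex; have := ps.1 _ _ Ex (EN Ex).
by rewrite subrr (sublinear0 ps); lra.
Qed.

Let sublinearZ p a x : sublinear_on p -> 0 <= a -> E x ->
  p (a *: x) = a * p x.
Proof.
move=> ps; rewrite le_eqVlt => /predU1P[<- _|a0 Ex].
  by rewrite scale0r mul0r sublinear0.
apply/eqP; rewrite eq_le ps.2//=.
have := ps.2 a^-1 (a *: x); rewrite invr_gt0 scalerA mulVf ?gt_eqF// scale1r.
by move=> /(_ a0 (EZ _ Ex)); rewrite -(ler_pM2l a0) mulrA divff ?gt_eqF// mul1r.
Qed.

Let minimal_below (q : V -> R) := forall q', sublinear_on q' ->
  (forall x, E x -> q' x <= q x) -> forall x, E x -> q x <= q' x.

(** Lower bounds of chains for Zorn's lemma. The infimum is finite because comparability with one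
    member [p] bounds every member at [x] from below by [- p (- x)]. For subadditivity, one member
    is chosen for each summand, and the smaller of the two serves both. *)
Let infimum_sublinear (C : set (V -> R)) (p : V -> R) : C p ->
  (forall q, C q -> sublinear_on q) ->
  (forall q q', C q -> C q' -> (forall x, E x -> q x <= q' x) \/
     (forall x, E x -> q' x <= q x)) ->
  let m x := inf [set q x | q in C] in
  sublinear_on m /\ forall q x, C q -> E x -> m x <= q x.
Proof.
move=> Cp Cs Ct m.
have lb x : E x -> lbound [set q x | q in C] (- p (- x)).
  move=> Ex _ [q Cq <-]; have qx := sublinearN (Cs _ Cq) Ex.
  have px := sublinearN (Cs _ Cp) Ex; have [pq|qp] := Ct _ _ Cp Cq.
    by rewrite (le_trans px)// pq.
  by rewrite (le_trans _ qx)// lerN2 qp//; exact: EN.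
have mq q x : C q -> E x -> m x <= q x.
  by move=> Cq Ex; apply: ge_inf; [exists (- p (- x)); exact: lb|exists q].
have le_m x b : (forall q, C q -> b <= q x) -> b <= m x.
  by move=> bq; apply: lb_le_inf; [exists (p x), p|move=> _ [q /bq ? <-]].
split => //; split=> [x y Ex Ey|a x a0 Ex].
  rewrite -lerBlDr; apply: (@le_m) => q1 Cq1.
  rewrite lerBlDr [leRHS]addrC -lerBlDr; apply: (@le_m) => q2 Cq2; rewrite lerBlDr [leRHS]addrC.
  have [q12|q21] := Ct _ _ Cq1 Cq2.
    rewrite (le_trans (mq _ _ Cq1 (ED Ex Ey)))// (le_trans ((Cs _ Cq1).1 _ _ _ _))//.
    by rewrite lerD2l q12.
  rewrite (le_trans (mq _ _ Cq2 (ED Ex Ey)))// (le_trans ((Cs _ Cq2).1 _ _ _ _))//.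
  by rewrite lerD2r q21.
rewrite -ler_pdivrMl//; apply: (@le_m) => q Cq; rewrite ler_pdivrMl//.
by rewrite (le_trans (mq _ _ Cq (EZ a Ex)))// (Cs _ Cq).2.
Qed.

(* Perturbing a minimal sublinear [q] in the direction [y] gives the sublinear
   [x |-> inf_(t >= 0) (q (x + t y) - t q y)], so q is superadditive. *)
Let minimal_additive q : sublinear_on q -> minimal_below q ->
  forall x y, E x -> E y -> q (x + y) = q x + q y.
Proof.
move=> qs qmin x y Ex Ey; apply/eqP; rewrite eq_le qs.1//=.
pose A z := [set q (z + t *: y) - t * q y | t in [set t | 0 <= t]].
pose q' z := inf (A z).
have A0 z : A z !=set0 by exists (q (z + 0 *: y) - 0 * q y), 0; rewrite /=.
have lbA z : E z -> lbound (A z) (- q (- z)).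
  move=> Ez _ [t /= t0 <-]; rewrite -(sublinearZ qs t0 Ey).
  have := qs.1 (z + t *: y) (- z).
  rewrite addrAC subrr add0r => /(_ (ED Ez (EZ t Ey)) (EN Ez)); lra.
have q'le z t : E z -> 0 <= t -> q' z <= q (z + t *: y) - t * q y.
  by move=> Ez t0; apply: ge_inf; [exists (- q (- z)); exact: lbA|exists t].
have q'q z : E z -> q' z <= q z.
  by move=> Ez; have := q'le z 0 Ez (lexx _); rewrite scale0r mul0r addr0 subr0.
have le_q' z b : (forall t, 0 <= t -> b <= q (z + t *: y) - t * q y) -> b <= q' z.
  by move=> bq; apply: lb_le_inf => // _ [t /bq ? <-].
have q's : sublinear_on q'.
  split=> [z1 z2 Ez1 Ez2|a z a0 Ez].
    rewrite -lerBlDr; apply: (@le_q') => t1 t10.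
    rewrite lerBlDr [leRHS]addrC -lerBlDr; apply: (@le_q') => t2 t20.
    rewrite lerBlDr (le_trans (q'le _ (t1 + t2) (ED Ez1 Ez2) (addr_ge0 t10 t20)))//.
    have := qs.1 _ _ (ED Ez1 (EZ t1 Ey)) (ED Ez2 (EZ t2 Ey)).
    by rewrite addrACA -scalerDl mulrDl; lra.
  rewrite -ler_pdivrMl//; apply: (@le_q') => t t0.
  rewrite ler_pdivrMl// (le_trans (q'le _ (a * t) (EZ a Ez) _))//.
    by rewrite mulr_ge0// ltW.
  by rewrite -scalerA -scalerDr mulrBr mulrA lerD2r qs.2//; exact/ED/EZ.
have := le_trans (qmin _ q's q'q x Ex) (q'le x 1 Ex ler01).
by rewrite scale1r mul1r lerBrDr.
Qed.

(** No functional on a smaller subspace is given: in the application [p] is an infimum over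
    majorants that encodes it. A minimal sublinear function below [p] is already linear. *)
Theorem hahn_banach_on (p : V -> R) : sublinear_on p ->
  exists l : V -> R, [/\ forall x y, E x -> E y -> l (x + y) = l x + l y,
    forall a x, E x -> l (a *: x) = a * l x &
    forall x, E x -> l x <= p x].
Proof.
move=> ps.
pose T := {q : V -> R | sublinear_on q /\ forall x, E x -> q x <= p x}.
pose r : rel T := fun q q' => `[< forall x, E x -> sval q' x <= sval q x >].
pose p0 : T := exist _ p (conj ps (fun x _ => lexx (p x))).
have [|||[l [ls lp]] lmin] := @ZL_preorder _ p0 r.
- by move=> q; apply/asboolP.
- move=> q1 q2 q3 /asboolP q12 /asboolP q23; apply/asboolP => x Ex.
  exact: le_trans (q23 _ Ex) (q12 _ Ex).
(* The chain may be empty; with [p] adjoined its infimum is defined and lies below [p]. *)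
- move=> A Atot; pose C := p |` [set sval q | q in A].
  have [|||ms mC] := @infimum_sublinear C p; first by left.
  + by move=> q [->//|[[q' [q's q'p]] _ <-]].
  + move=> q q' [->|[q1 Aq1 <-]] [->|[q2 Aq2 <-]].
    * by left.
    * by right; case: (svalP q2).
    * by left; case: (svalP q1).
    * by have /orP[/asboolP|/asboolP] : r q1 q2 || r q2 q1;
        [apply/orP; exact: Atot|right|left].
  + have mp x (Ex : E x) := mC p x (or_introl erefl) Ex.
    pose mT : T := exist _ (fun x => inf [set q x | q in C]) (conj ms mp).
    exists mT => s As; apply/asboolP => x Ex /=.
    by apply: mC => //; right; exists s.
- have lmin' : minimal_below l.
    move=> q qs ql x Ex; have qp y (Ey : E y) := le_trans (ql y Ey) (lp y Ey).
    have := lmin (exist _ q (conj qs qp) : T); rewrite /r !asboolE /=; move=> /(_ ql).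
    exact.
  have ladd := minimal_additive ls lmin'.
  exists l; split => // a x Ex.
  have [a0|a0] := leP 0 a; first exact: sublinearZ.
  have := ladd (a *: x) (- a *: x) (EZ _ Ex) (EZ _ Ex).
  rewrite -scalerDl subrr scale0r sublinear0// (sublinearZ (a := - a))//; last first.
    by rewrite oppr_ge0 ltW.
  by lra.
Qed.

End hahn_banach.

(** * Measures from positive functionals on zero-dimensional spaces *)

Section compact_open_ring.
Context (S : ptopologicalType).

Definition compact_clopen : set (set S) :=
  [set A | [/\ open A, closed A & compact A]].

Lemma compact_clopen0 : compact_clopen set0.
Proof. by split; [exact: open0|exact: closed0|exact: compact0]. Qed.

Lemma compact_clopenU : setU_closed compact_clopen.
Proof.
move=> A B [oA cA kA] [oB cB kB].
by split; [exact: openU|exact: closedU|exact: compactU].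
Qed.

Lemma compact_clopenD : setD_closed compact_clopen.
Proof.
move=> A B [oA cA kA] [oB cB kB]; have cAB : closed (A `\` B).
  by rewrite setDE; apply: closedI => //; exact: open_closedC.
split => //; first by rewrite setDE; apply: openI => //; exact: closed_openC.
by apply: (subclosed_compact cAB kA); exact: subDsetl.
Qed.

Lemma compact_clopenI A B : compact_clopen A -> compact_clopen B ->
  compact_clopen (A `&` B).
Proof. by move=> cA cB; rewrite -setDD; do 2 apply: compact_clopenD => //. Qed.

(** Reduces countable additivity to finite additivity: when a compact open set is a countable
    disjoint union of open sets, the partial unions are eventually the whole set. *)
Lemma compact_bigcup_finite (F : nat -> set S) : (forall i, open (F i)) ->
  compact (\bigcup_i F i) -> exists N, forall x, (\bigcup_i F i) x ->
    exists2 i, (i < N)%N & F i x.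
Proof.
move=> oF; rewrite compact_cover => /(_ _ setT F (fun i _ => oF i)).
move=> /(_ (@subset_refl _ _))[D _ FD]; exists (\max_(i <- finmap.enum_fset D) i).+1.
move=> x /FD[i /= Di Fix]; exists i => //.
by rewrite ltnS; exact: leq_bigmax_seq.
Qed.

(** An alias of [S] whose measurable sets are the compact open ones. They form a ring of sets only,
    since [S] itself need not be compact. *)
Definition compact_clopen_type : Type := S.

Definition compact_clopen_display : Type -> measure_display. Proof. exact. Qed.

HB.instance Definition _ := Pointed.on compact_clopen_type.
HB.instance Definition _ := @isRingOfSets.Build (compact_clopen_display S)
  compact_clopen_type compact_clopen compact_clopen0 compact_clopenU
  compact_clopenD.

End compact_open_ring.

(** * Positive functionals on solid spaces of functions *)

Section positive_functional.
Context (R : realType) (S : Type) (E : set (S -> R)).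

Record positive_functional (L : (S -> R) -> R) : Prop := PositiveFunctional {
  pfunD : forall f g, E f -> E g -> L (f \+ g) = L f + L g ;
  pfunZ : forall a f, E f -> L (fun x => a * f x) = a * L f ;
  pfun_ge0 : forall f, E f -> (forall x, 0 <= f x) -> 0 <= L f }.

(** Solidity takes the place of any regularity condition: with [f], the product of [f] with the
    indicator of an arbitrary set stays in the space. *)
Record dominated_space : Prop := DominatedSpace {
  dspD : forall f g, E f -> E g -> E (f \+ g) ;
  dspZ : forall a f, E f -> E (fun x => a * f x) ;
  dsp_solid : forall f g, E f -> (forall x, `|g x| <= `|f x|) -> E g ;
  dsp1 : E (cst 1) }.

Variable L : (S -> R) -> R.
Hypothesis (Edom : dominated_space) (Lpos : positive_functional L).

Lemma pfun0 : L (cst 0) = 0.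
Proof.
have := pfunZ Lpos 0 (dsp1 Edom); rewrite mul0r => L0; rewrite -[RHS]L0; congr (L _).
by apply/funext => x; rewrite mul0r.
Qed.

Lemma dspB f g : E f -> E g -> E (f \- g).
Proof.
move=> Ef Eg; have := dspD Edom Ef (dspZ Edom (-1) Eg).
by congr (E _); apply/funext => x /=; rewrite mulN1r.
Qed.

Lemma pfunB f g : E f -> E g -> L (f \- g) = L f - L g.
Proof.
move=> Ef Eg; rewrite -[in RHS]mulN1r -(pfunZ Lpos)// -(pfunD Lpos)//.
  by congr (L _); apply/funext => x /=; rewrite mulN1r.
exact: dspZ.
Qed.

Lemma pfun_le f g : E f -> E g -> (forall x, f x <= g x) -> L f <= L g.
Proof.
move=> Ef Eg fg; rewrite -subr_ge0 -pfunB//; apply: (pfun_ge0 Lpos).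
  exact: dspB.
by move=> x /=; rewrite subr_ge0.
Qed.

Lemma dsp_restrict f (A : set S) : E f -> E (fun x => f x * \1_A x).
Proof.
move=> Ef; apply: (dsp_solid Edom Ef) => x.
by rewrite normrM indicE; case: (x \in A); rewrite ?normr1 ?mulr1// normr0 mulr0.
Qed.

Lemma dsp_indic (A : set S) : E \1_A.
Proof.
have := dsp_restrict A (dsp1 Edom); congr (E _).
by apply/funext => x; rewrite mul1r.
Qed.

Lemma pfun_indic_ge0 (A : set S) : 0 <= L \1_A.
Proof. by apply: (pfun_ge0 Lpos); [exact: dsp_indic|move=> x; rewrite indicE]. Qed.

Lemma pfun_restrictU f (A B : set S) : E f -> A `&` B = set0 ->
  L (fun x => f x * \1_(A `|` B) x) =
  L (fun x => f x * \1_A x) + L (fun x => f x * \1_B x).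
Proof.
move=> Ef AB0; rewrite -(pfunD Lpos); [|exact: dsp_restrict..].
congr (L _); apply/funext => x /=; rewrite -mulrDr !indicE in_setU -natrD.
congr (_ * _%:R); case xA: (x \in A); case xB: (x \in B) => //.
by have : (A `&` B) x; [split; exact/set_mem|rewrite AB0].
Qed.

Lemma pfun_indicU (A B : set S) : A `&` B = set0 ->
  L \1_(A `|` B) = L \1_A + L \1_B.
Proof.
move=> /(pfun_restrictU (dsp1 Edom)).
have c1 (C : set S) : (fun x => cst 1 x * \1_C x) = \1_C :> (S -> R).
  by apply/funext => x; rewrite mul1r.
by rewrite !c1.
Qed.

End positive_functional.

Section clopen_measure.
Context (R : realType) (S : ptopologicalType) (E : set (S -> R)).
Variable L : (S -> R) -> R.
Hypothesis (Edom : dominated_space E) (Lpos : positive_functional E L).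

Let T := compact_clopen_type S.

Definition clopen_content (A : set T) : \bar R := (L (\1_(A : set S)))%:E.

Let clopen_content0 : clopen_content set0 = 0%E.
Proof. by rewrite /clopen_content indic0 (pfun0 Edom Lpos). Qed.

Let clopen_content_ge0 A : (0 <= clopen_content A)%E.
Proof. by rewrite lee_fin (pfun_indic_ge0 Edom Lpos). Qed.

Let clopen_content_sigma_additive : semi_sigma_additive clopen_content.
Proof.
move=> F mF tF mU; have oF i : open (F i : set S) by case: (mF i).
have [_ _ kU] := mU; have [N FN] := compact_bigcup_finite oF kU.
have sumE n : \sum_(0 <= i < n) clopen_content (F i) =
    clopen_content (\big[setU/set0]_(i < n) F i).
  elim: n => [|n ih]; first by rewrite big_nil big_ord0 clopen_content0.
  rewrite big_nat_recr//= ih big_ord_recr/= /clopen_content.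
  rewrite (pfun_indicU Edom Lpos)// -bigcup_mkord -subset0 => x [[i /= ni Fix]].
  move=> Fnx; have ni' : i <> n by move=> in'; rewrite in' ltnn in ni.
  by have [] := ni'; apply: (tF _ _ I I); exists x.
apply/cvg_ballP => e e0; near=> n; rewrite sumE.
suff -> : \big[setU/set0]_(i < n) F i = \bigcup_i F i by exact: ballxx.
rewrite -bigcup_mkord; apply/seteqP; split=> [x [i _ Fx]|x]; first by exists i.
move=> /FN[i iN Fx]; exists i => //=; apply: (leq_trans iN).
by near: n; exact: nbhs_infty_ge.
Unshelve. all: by end_near. Qed.

HB.instance Definition _ := isMeasure.Build _ _ _ clopen_content
  clopen_content0 clopen_content_ge0 clopen_content_sigma_additive.

Definition clopen_measure : {measure set T -> \bar R} := clopen_content.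

End clopen_measure.

Lemma pushforward_measure d d' (T1 : measurableType d) (T2 : measurableType d')
    (R : realType) (m : {measure set T1 -> \bar R}) (f : T1 -> T2) :
  measurable_fun setT f ->
  exists nu : {measure set T2 -> \bar R},
    nu = pushforward m f :> (set T2 -> \bar R).
Proof.
move=> mf.
by unshelve eexists [the {measure set T2 -> \bar R} of pushforward m f].
Qed.

Lemma borel_measurable_fun d (T : measurableType d) (S : ptopologicalType)
    (f : T -> borel S) :
  (forall U, open U -> measurable (f @^-1` U)) -> measurable_fun setT f.
Proof.
move=> mU; apply: (@measurability _ _ _ _ setT f (@open S) erefl) => _ [U oU <-].
by rewrite setTI; exact: mU.
Qed.

Lemma open_borel_measurable (S : ptopologicalType) (U : set S) : open U ->
  measurable (U : set (borel S)).
Proof. by move=> oU; exact: sub_sigma_algebra. Qed.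

Lemma closed_borel_measurable (S : ptopologicalType) (C : set S) : closed C ->
  measurable (C : set (borel S)).
Proof.
move=> cC; rewrite -(setCK C); apply: measurableC. by apply: (@open_borel_measurable S); exact: (@closed_openC S).
Qed.

Lemma continuous_borel_measurable (S S' : ptopologicalType) (f : S -> S') :
  continuous f -> measurable_fun setT (f : borel S -> borel S').
Proof.
move=> cf; apply: borel_measurable_fun => U oU.
by apply: open_borel_measurable; apply: open_comp => // ? _; exact: cf.
Qed.

Lemma continuous_borel_measurableR (R : realType) (S : ptopologicalType)
    (f : S -> R) : continuous f -> measurable_fun setT (f : borel S -> R).
Proof.
move=> cf; apply: (measurability _ (RGenOpens.measurableE R)) => _ [_ [a [b ->] <-]].
rewrite setTI; apply: (@open_borel_measurable S).
by apply: open_comp; [move=> ? _; exact: cf|exact: interval_open].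
Qed.

Lemma compact_clopen_exhaustion (S : ptopologicalType) (W : nat -> set S) :
  (forall n, compact_clopen (W n)) ->
  (forall x U, nbhs x U -> exists2 n, W n x & W n `<=` U) ->
  exists V : nat -> set S, [/\ forall n, compact_clopen (V n),
    nondecreasing_seq V & \bigcup_n V n = setT].
Proof.
move=> Wclopen Wbase; exists (fun n => \big[setU/set0]_(i < n) W i); split.
- move=> n; elim/big_ind : _ => //; first exact: compact_clopen0.
  exact: compact_clopenU.
- move=> m n mn; rewrite subsetEset -!bigcup_mkord; apply: bigcup_sub => i /= im.
  by apply: bigcup_sup => /=; exact: leq_trans im mn.
- apply/seteqP; split=> // x _.
  have [n Wx _] := Wbase x setT (@filterT _ (nbhs x) (nbhs_filter x)).
  by exists n.+1 => //; rewrite -bigcup_mkord; exists n => /=.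
Qed.

Section clopen_extension.
Context (R : realType) (S : ptopologicalType) (E : set (S -> R)).
Variable L : (S -> R) -> R.
Hypothesis (Edom : dominated_space E) (Lpos : positive_functional E L).
Variable W : nat -> set S.
Hypothesis Wclopen : forall n, compact_clopen (W n).
Hypothesis Wbase : forall x U, nbhs x U -> exists2 n, W n x & W n `<=` U.

(** Every open set is a countable union of members of the base, so the ring of compact open sets
    generates the Borel sets. The total mass is at most [L (cst 1)], by an exhaustion. Outer
    regularity is built into the outer measure, an infimum over countable covers by compact open
    sets: the union of such a cover is open. *)
Theorem clopen_measure_extension : exists nu : {measure set (borel S) -> \bar R},
  [/\ forall A : set S, compact_clopen A -> nu A = (L \1_A)%:E,
      (nu setT < +oo)%E &
      forall (A : set (borel S)) (e : R), measurable A -> 0 < e ->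
        exists U : set S, [/\ open U, A `<=` U & (nu U <= nu A + e%:E)%E]].
Proof.
pose T := compact_clopen_type S.
pose mu := clopen_measure Edom Lpos.
have open_bigcup (U : set S) : open U -> U = \bigcup_(n in [set n | W n `<=` U]) W n.
  move=> oU; apply/seteqP; split=> [x Ux|x [n /= WU /WU//]].
  by have [n Wx WU] := Wbase (open_nbhs_nbhs (conj oU Ux)); exists n.
pose I : measurableType _ := g_sigma_algebraType (@measurable _ T).
have mid : measurable_fun [set: I] (idfun : I -> borel S).
  apply: borel_measurable_fun => U oU; rewrite preimage_id [X in measurable X]open_bigcup//.
  by apply: bigcup_measurable => n _; apply: sub_sigma_algebra; exact: Wclopen.
(* The extension lives on the sigma-algebra generated by the ring; the identity map transports it to
   the Borel one. *)
have [nu nuE] := pushforward_measure (measure_extension mu) mid.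
have nu_clopen (A : set S) : compact_clopen A -> nu A = (L \1_A)%:E.
  by move=> kA; rewrite nuE/= /pushforward /measure_extension measurable_mu_extE.
have nu_fin : (nu setT < +oo)%E.
  have [V [kV ndV VT]] := compact_clopen_exhaustion Wclopen Wbase.
  rewrite -VT; have mV n : measurable (V n : set (borel S)).
    by have [oV _ _] := kV n; exact: open_borel_measurable.
  apply: (@le_lt_trans _ _ (L (cst 1))%:E); last exact: ltry.
  have : nu \o V @ \oo --> nu (\bigcup_n V n).
    by apply: nondecreasing_cvg_mu => //; exact: bigcup_measurable.
  move=> /cvg_lim <-//; apply: lime_le.
    apply: ereal_nondecreasing_is_cvgn => m n mn; rewrite /= le_measure ?inE//.
    by rewrite -subsetEset; exact: ndV.
  near=> n; rewrite /= nu_clopen// lee_fin (pfun_le Edom Lpos)//.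
  - exact: dsp_indic.
  - exact: dsp1.
  - by move=> x; rewrite indicE; case: (x \in V n).
exists nu; split => // A e mA e0.
have : mu_ext mu A \is a fin_num.
  rewrite ge0_fin_numE; last exact: mu_ext_ge0.
  have -> : mu_ext mu A = nu A by rewrite nuE.
  by rewrite (le_lt_trans _ nu_fin)// le_measure ?inE.
move=> /lb_ereal_inf_adherent -/(_ _ e0)[_ [F [mF AF] <-] Fe].
have oF i : open (F i : set S) by case: (mF i).
exists (\bigcup_i F i); split => //; first exact: bigcup_open.
have mF' i : measurable (F i : set (borel S)) by exact: open_borel_measurable.
have FU : nu (\bigcup_i F i) = (mu^*)%mu (\bigcup_i F i) by rewrite nuE.
rewrite FU nuE/= (le_trans _ (ltW Fe))//.
apply: (le_trans (outer_measure_sigma_subadditive (mu_ext mu) F)).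
apply: lee_nneseries => // i _.
by rewrite -[leRHS]/(mu (F i)) -(measurable_mu_extE mu (mF i)).
Unshelve. all: by end_near. Qed.

(* Outer regularity of the complement gives a closed set inside [A], which is
   cut down to a compact set by the exhaustion. *)
Lemma outer_regular_inner (nu : {measure set (borel S) -> \bar R})
    (A : set (borel S)) (e : R) :
  (nu setT < +oo)%E ->
  (forall (A : set (borel S)) (e : R), measurable A -> 0 < e ->
        exists U : set S, [/\ open U, A `<=` U & (nu U <= nu A + e%:E)%E]) ->
  measurable A -> 0 < e ->
  exists K : set S, [/\ compact K, closed K, K `<=` A & (nu A <= nu K + e%:E)%E].
Proof.
move=> nufin nureg mA e0; have e20 : 0 < e / 2 by rewrite divr_gt0.
have [U [oU AU nuU]] := nureg (~` A) (e / 2) (measurableC mA) e20.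
have fin (B : set (borel S)) : measurable B -> nu B \is a fin_num.
  move=> mB; rewrite ge0_fin_numE//.
  by rewrite (le_lt_trans _ nufin)// le_measure ?inE.
have mU := open_borel_measurable oU; have cU := open_closedC oU.
have [V [kV ndV VT]] := compact_clopen_exhaustion Wclopen Wbase.
have mUV n : measurable (~` U `&` V n : set (borel S)).
  by apply: closed_borel_measurable; apply: closedI => //; case: (kV n).
have : nu \o (fun n => ~` U `&` V n) @ \oo --> nu (~` U).
  rewrite -[X in _ --> nu X](setIT (~` U)) -VT setI_bigcupr.
  apply: nondecreasing_cvg_mu => //; first exact: bigcup_measurable.
  by move=> m n mn; rewrite subsetEset; apply: setIS; rewrite -subsetEset; exact: ndV.
have mUC := closed_borel_measurable cU.
rewrite -(fineK (fin _ mUC)) => /fine_cvgP[_ /cvgrPdist_le/(_ _ e20)].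
move=> [N _ /(_ N (leqnn N))]; set K := (~` U `&` V N) => NK.
exists K; split.
- rewrite /K setIC; apply: compact_closedI => //; by case: (kV N).
- by apply: closedI => //; case: (kV N).
- by move=> x [Ux _]; apply: contrapT => /AU.
move: NK; rewrite /comp -/K => NK.
have nuAC : nu setT = (nu A + nu (~` A))%E.
  by rewrite -measureU//; [rewrite setUCr|exact: measurableC|rewrite setICr].
have nuUC : nu setT = (nu U + nu (~` U))%E.
  by rewrite -measureU//; [rewrite setUCr|rewrite setICr].
have := nuAC; rewrite nuUC; move: nuU NK.
have mK : measurable (K : set (borel S)) by exact: mUV.
rewrite -(fineK (fin _ mA)) -(fineK (fin _ mU)) -(fineK (fin _ mK)).
rewrite -(fineK (fin _ mUC)) -(fineK (fin _ (measurableC mA))) -!EFinD/= !lee_fin.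
move=> nuU /ler_normlP[_ NK] [] /=; lra.
Qed.

End clopen_extension.

(** * Comparison of the functional with the integral *)

Section functional_integral.
Context (R : realType) (S : ptopologicalType) (E : set (S -> R)).
Variable L : (S -> R) -> R.
Hypothesis (Edom : dominated_space E) (Lpos : positive_functional E L).
Variable W : nat -> set S.
Hypothesis Wclopen : forall n, compact_clopen (W n).
Hypothesis Wbase : forall x U, nbhs x U -> exists2 n, W n x & W n `<=` U.
Variable nu : {measure set (borel S) -> \bar R}.
Hypothesis nuE : forall A : set S, compact_clopen A -> nu A = (L \1_A)%:E.

Let mclopen (A : set S) : compact_clopen A -> measurable (A : set (borel S)).
Proof. by case=> oA _ _; exact: open_borel_measurable. Qed.

Section continuous_function.
Variable f : S -> R.
Hypotheses (f0 : forall x, 0 <= f x) (cf : continuous f) (Ef : E f).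

Let mf (A : set (borel S)) : measurable_fun A (fun x : borel S => (f x)%:E).
Proof.
apply/measurable_EFinP; apply: measurable_funTS.
exact: continuous_borel_measurableR.
Qed.

(** The error is proportional to the mass of [A], so that errors over disjoint pieces add up to an
    error of the same form. *)
Let close_on (e : R) (A : set S) :=
  ((L (fun x => f x * \1_A x) - e * L \1_A)%:E <= \int[nu]_(x in A) (f x)%:E)%E
  /\ (\int[nu]_(x in A) (f x)%:E <= (L (fun x => f x * \1_A x) + e * L \1_A)%:E)%E.

(** On [A] the function lies within [e / 2] of its value at a point [x0], so both the integral and
    the functional lie between [f x0 - e / 2] and [f x0 + e / 2] times the mass of [A]. *)
Let close_on_small (e : R) (A : set S) : 0 <= e -> compact_clopen A ->
  (forall x y, A x -> A y -> `|f x - f y| <= e / 2) -> close_on e A.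
Proof.
move=> e0 kA fA; have [A0|/set0P[x0 Ax0]] := eqVneq A set0.
  have L1 : L \1_A = 0 by rewrite A0 indic0 (pfun0 Edom Lpos).
  have Lf : L (fun x => f x * \1_A x) = 0.
    rewrite -(pfun0 Edom Lpos); congr (L _); apply/funext => x.
    by rewrite A0 indic0 mulr0.
  by rewrite /close_on Lf L1 mulr0 subr0 addr0 A0 integral_set0.
have L0 := pfun_indic_ge0 Edom Lpos A; have mA := mclopen kA.
have intc c : (\int[nu]_(x in A) c%:E = (c * L \1_A)%:E)%E.
  by rewrite integral_cst// EFinM nuE.
have fub x : A x -> f x <= f x0 + e / 2.
  by move=> Ax; have := fA _ _ Ax Ax0; rewrite ler_norml => /andP[_]; lra.
have flb x : A x -> f x0 - e / 2 <= f x.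
  by move=> Ax; have := fA _ _ Ax Ax0; rewrite ler_norml => /andP[]; lra.
(* Truncation at [0] keeps the lower constant nonnegative, as monotonicity is applied to integrals
   of nonnegative functions. *)
pose m := Num.max 0 (f x0 - e / 2).
have fm x : A x -> m <= f x by move=> Ax; rewrite /m ge_max f0 flb.
have Ic c : E (fun x => c * \1_A x) by apply: (dspZ Edom); exact: dsp_indic.
have EfA : E (fun x => f x * \1_A x) by exact: dsp_restrict.
have LZ c : L (fun x => c * \1_A x) = c * L \1_A.
  by apply: (pfunZ Lpos); exact: dsp_indic.
have Lub : L (fun x => f x * \1_A x) <= (f x0 + e / 2) * L \1_A.
  rewrite -LZ (pfun_le Edom Lpos)// => x; rewrite indicE.
  case: (boolP (x \in A)) => [/set_mem/fub|_]; first by rewrite !mulr1.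
  by rewrite !mulr0.
have Llb : m * L \1_A <= L (fun x => f x * \1_A x).
  rewrite -LZ (pfun_le Edom Lpos)// => x; rewrite indicE.
  case: (boolP (x \in A)) => [/set_mem/fm|_]; first by rewrite !mulr1.
  by rewrite !mulr0.
have fx0 : 0 <= f x0 + e / 2 by rewrite addr_ge0// divr_ge0.
have m0 : 0 <= m by rewrite /m le_max lexx.
have Ilb : ((m * L \1_A)%:E <= \int[nu]_(x in A) (f x)%:E)%E.
  by rewrite -intc; apply: ge0_le_integral => //= x Ax; rewrite lee_fin fm.
have Iub : (\int[nu]_(x in A) (f x)%:E <= ((f x0 + e / 2) * L \1_A)%:E)%E.
  rewrite -intc; apply: ge0_le_integral => //= x Ax; rewrite lee_fin ?fub//.
have mlb : f x0 - e / 2 <= m by rewrite /m le_max lexx orbT.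
have eL : e * L \1_A = e / 2 * L \1_A + e / 2 * L \1_A.
  by rewrite -mulrDl -splitr.
have mL : (f x0 - e / 2) * L \1_A <= m * L \1_A by rewrite ler_wpM2r.
split; [apply: le_trans Ilb|apply: (le_trans Iub)]; rewrite lee_fin eL.
  by rewrite lerBlDr (le_trans Lub)//; move: mL; rewrite mulrBl mulrDl; lra.
by move: mL; rewrite mulrBl mulrDl; lra.
Qed.

Let close_onU (e : R) (A B : set S) : compact_clopen A -> compact_clopen B ->
  A `&` B = set0 -> close_on e A -> close_on e B -> close_on e (A `|` B).
Proof.
move=> kA kB AB0 [lA uA] [lB uB].
rewrite /close_on (pfun_restrictU Edom Lpos)// (pfun_indicU Edom Lpos)//.
rewrite (ge0_integral_setU _ (mclopen kA) (mclopen kB) (@mf _))//=; last 2 first.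
- by move=> x _; rewrite lee_fin.
- by apply/disj_setPS; rewrite AB0.
have key (iA iB : \bar R) a b c d : ((a - c)%:E <= iA)%E -> (iA <= (a + c)%:E)%E ->
    ((b - d)%:E <= iB)%E -> (iB <= (b + d)%:E)%E ->
    ((a + b - (c + d))%:E <= iA + iB)%E /\ (iA + iB <= (a + b + (c + d))%:E)%E.
  move=> aA Aa bB Bb.
  rewrite [a + b + (c + d)]addrACA opprD [a + b + (- c - d)]addrACA.
  by rewrite (EFinD (a - c)) (EFinD (a + c)); split; exact: leeD.
by rewrite mulrDr; exact: key.
Qed.

Let close_on_clopen (e : R) (A : set S) : 0 < e -> compact_clopen A ->
  close_on e A.
Proof.
move=> e0 kA; have e40 : 0 < e / 4 by rewrite divr_gt0.
pose small (B : set S) := forall x y, B x -> B y -> `|f x - f y| <= e / 2.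
(* Basic sets with too large an oscillation are replaced by [set0]. By continuity the others still
   cover [A]: values within [e / 4] of [f x] differ by at most [e / 2]. *)
pose V n := if `[< small (W n) >] then W n `&` A else set0.
have kV n : compact_clopen (V n).
  rewrite /V; case: ifP => _; last exact: compact_clopen0.
  exact: compact_clopenI.
have sV n : small (V n).
  rewrite /V; case: ifP => [/asboolP sW x y [Wx _] [Wy _]|_ x y //]; exact: sW.
have AV : \bigcup_n V n = A.
  apply/seteqP; split=> [x [n _]|x Ax].
    by rewrite /V; case: ifP => // _ [].
  have := @cf x => /(@cvgrPdist_lt _ R)/(_ _ e40) /(@Wbase x)[n Wx WU].
  exists n => //; rewrite /V ifT//; apply/asboolP => y z /WU /= yx /WU /= zx.
  rewrite (_ : f y - f z = (f x - f z) - (f x - f y)); last by lra.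
  by rewrite (le_trans (ler_normB _ _))//; lra.
have [oV _ _] := all_and3 kV; have [_ _ cA] := kA.
rewrite -AV in cA; have [N VN] := compact_bigcup_finite oV cA.
pose U n := \big[setU/set0]_(i < n) V i.
have kU n : compact_clopen (U n).
  rewrite /U; elim/big_ind : _ => //; first exact: compact_clopen0.
  exact: compact_clopenU.
have -> : A = U N.
  rewrite -AV /U -bigcup_mkord; apply/seteqP; split=> [x /VN[i iN Vx]|x [i _ Vx]].
    by exists i.
  by exists i.
elim: N {VN} => [|n ih].
  rewrite /U big_ord0; apply: close_on_small => //; first exact: ltW.
  exact: compact_clopen0.
have -> : U n.+1 = U n `|` (V n `\` U n).
  by rewrite setUDr setDv setD0 /U big_ord_recr.
have kD : compact_clopen (V n `\` U n) by exact: compact_clopenD.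
apply: close_onU => //; first by rewrite setDIK.
apply: close_on_small => //; first exact: ltW.
by move=> x y [Vx _] [Vy _]; exact: (sV n).
Qed.

Lemma clopen_integral (A : set S) : compact_clopen A ->
  (\int[nu]_(x in A) (f x)%:E = (L (fun x => f x * \1_A x))%:E)%E.
Proof.
move=> kA; have L0 := pfun_indic_ge0 Edom Lpos A.
(* The precision used is [e / (L \1_A + 1)]; the [+ 1] keeps the divisor positive when [L \1_A]
   vanishes. *)
have d0 : 0 < L \1_A + 1 by rewrite ltr_wpDl.
have small (e : R) : 0 < e -> e / (L \1_A + 1) * L \1_A <= e.
  move=> e0; rewrite mulrAC ler_pdivrMr// ler_pM2l// lerDl; lra.
apply/eqP; rewrite eq_le; apply/andP; split; apply/lee_addgt0Pr => e e0.
  have [_ /le_trans] := close_on_clopen (divr_gt0 e0 d0) kA; apply.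
  by rewrite -EFinD lee_fin lerD2l small.
have [+ _] := close_on_clopen (divr_gt0 e0 d0) kA.
rewrite EFinB leeBlDr// => /le_trans; apply.
by rewrite leeD2l// lee_fin small.
Qed.

(** Monotone convergence along an exhaustion by compact open sets. The inequality can be strict, as
    [L] may see mass at infinity; it suffices for the third moment. *)
Lemma integral_le_functional : (\int[nu]_x (f x)%:E <= (L f)%:E)%E.
Proof.
have [V [kV ndV VT]] := compact_clopen_exhaustion Wclopen Wbase.
have mV n : measurable (V n : set (borel S)) by exact: mclopen.
have f0E n x : V n x -> (0 <= (f x)%:E)%E by rewrite lee_fin.
rewrite -VT; have /cvg_lim <- // := ge0_nondecreasing_set_cvg_integral (mu := nu) ndV mV
  (fun n => @mf (V n)) f0E.
apply: lime_le.
  apply: ereal_nondecreasing_is_cvgn.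
  exact: ge0_nondecreasing_set_nondecreasing_integral.
near=> n; rewrite clopen_integral// lee_fin (pfun_le Edom Lpos)//.
  exact: dsp_restrict.
by move=> x; rewrite indicE; case: (x \in V n); rewrite ?mulr1// mulr0.
Unshelve. all: by end_near. Qed.

(** The hypothesis is tightness: outside a suitable compact open set [f] contributes at most [e] to
    the functional, so nothing escapes to infinity. *)
Lemma integral_functional :
  (forall e, 0 < e -> exists2 A : set S, compact_clopen A &
     L (fun x => f x * \1_(~` A) x) <= e) ->
  (\int[nu]_x (f x)%:E = (L f)%:E)%E.
Proof.
move=> tail; apply/eqP; rewrite eq_le integral_le_functional/=.
apply/lee_addgt0Pr => e e0; have [A kA Ae] := tail _ e0.
have -> : L f = L (fun x => f x * \1_A x) + L (fun x => f x * \1_(~` A) x).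
  rewrite -(pfun_restrictU Edom Lpos)// ?setICr//; congr (L _).
  by apply/funext => x; rewrite setUCr indicT mulr1.
rewrite EFinD -clopen_integral// leeD ?lee_fin//.
apply: ge0_subset_integral => //=; first exact: mclopen.
by move=> x _; rewrite lee_fin.
Qed.

End continuous_function.
End functional_integral.

(** * Coding by the Cantor space *)

Lemma second_countable_base (X : ptopologicalType) : @second_countable X ->
  exists2 U : nat -> set X, forall n, open (U n) &
    forall x V, nbhs x V -> exists2 n, U n x & U n `<=` V.
Proof.
move=> [B cB [oB Bbase]].
have [B0|/unsquash U] : B = set0 \/ $|{surjfun [set: nat] >-> B}| by exact/pfcard_geP.
  by have [V [BV _] _] := Bbase point setT filterT; rewrite B0 in BV.
exists U => [n|x V xV]; first by apply: oB; exact: funS.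
have [A [BA Ax] AV] := Bbase x V xV.
by have [n _ UA] := @surj _ _ _ _ U _ BA; exists n; rewrite UA.
Qed.

Definition Cantor : Type := tree_of (fun _ : nat => bool).

HB.instance Definition _ := Pointed.on Cantor.
HB.instance Definition _ := Topological.on Cantor.

Lemma Cantor_like : cantor_like Cantor.
Proof.
apply: cantor_like_finite_prod => n; first exact: finite_finset.
by exists (true, false).
Qed.

Lemma Cantor_continuous (T : topologicalType) (f : T -> Cantor) :
  (forall n b, open [set t | f t n = b]) -> continuous f.
Proof.
move=> of_ t; apply/cvg_sup => n.
apply: continuous_comp_initial t => t A /nbhs_singleton At.
apply: (@filterS _ _ _ [set s | f s n = f t n]).
  by move=> s /= st; rewrite /= st.
by apply: open_nbhs_nbhs; split.
Qed.

Lemma Cantor_coord_open n b : open [set c : Cantor | c n = b].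
Proof.
apply: (@open_comp Cantor (discrete_topology bool) (proj n) [set b]).
  by move=> c _; exact: proj_continuous.
exact: discrete_open.
Qed.

(* The two closed pieces [closure (U n)] and [~` U n] cover X; a pair of
   distinct points is separated by one of these covers, so that the tree which
   they generate has at most one point on each branch. *)
Lemma Cantor_surjection (X : ptopologicalType) : compact [set: X] ->
  hausdorff_space X -> @second_countable X ->
  exists2 g : Cantor -> X, continuous g & forall x, exists c, g c = x.
Proof.
move=> cX hX /second_countable_base[U oU Ubase].
pose C n (b : bool) := if b then closure (U n) else ~` U n.
have cC n b : closed (C n b).
  by case: b; [exact: closed_closure|exact: open_closedC].
have covC n x : exists b, C n b x.
  have [Ux|Ux] := pselect (U n x); last by exists false.
  by exists true; exact: subset_closure.
(* If the piece [C n b] misses [V], the other piece is taken instead: the children of a node must be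
   nonempty for every branch to reach a point. *)
pose r n (V : set X) (b : bool) :=
  (if pselect (C n b `&` V !=set0) then C n b else C n (~~ b)) `&` V.
have [| | | | | |f [cf sf _]] := @tree_map_props
    (fun=> discrete_topology bool) X r (fun V => closed V /\ V !=set0) cX hX.
- move=> n V; apply/seteqP; split=> [x Vx|x [b _ []]//].
  have [b Cx] := covC n x; exists b => //; rewrite /r.
  by case: pselect => // -[]; exists x.
- move=> n V b [cV [x Vx]]; split.
    by rewrite /r; case: pselect => ?; exact: closedI.
  rewrite /r; case: pselect => // CV; exists x; split => //.
  have [b' Cx] := covC n x; case: (eqVneq b' b) Cx => [->|] Cx.
    by case: CV; exists x.
  by move: Cx CV; case: b; case: b' => // Cx.
- by move=> V [].
- by split; [exact: closedT|exists point].
- by move=> V [].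
- move=> x y xy; move: hX; rewrite open_hausdorff => /(_ _ _ xy)[[A B]]/=.
  rewrite !inE => -[Ax By] [oA oB AB0].
  have [n Ux UA] := Ubase x A (open_nbhs_nbhs (conj oA Ax)).
  have ny : ~ closure (U n) y.
    move=> /(_ B (open_nbhs_nbhs (conj oB By)))[z [/UA Az Bz]].
    by rewrite -[False]/(set0 z) -AB0.
  exists n => V b; rewrite /r; case: pselect => _ [+ _] [+ _].
    by case: b.
  by case: b.
- by exists f => // x; have [c _ <-] := sf x I; exists c.
Qed.

Section nat_Cantor.
Variable R : realType.

Definition config_code : Type := (nat * Cantor)%type.

HB.instance Definition _ := Pointed.on config_code.
HB.instance Definition _ := Topological.on config_code.

Lemma setX_clopen (k : nat) (V : set Cantor) : clopen V ->
  compact_clopen ([set k] `*` V : set config_code).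
Proof.
move=> [oV cV]; have E : [set k] `*` V = (fst @^-1` [set k]) `&` (snd @^-1` V).
  by apply/seteqP; split.
have cfst : continuous (fst : config_code -> nat) by move=> ?; exact: cvg_fst.
have csnd : continuous (snd : config_code -> Cantor) by move=> ?; exact: cvg_snd.
split.
- rewrite E; apply: openI; first by apply: open_comp => //; exact: discrete_open.
  exact: open_comp.
- rewrite E; apply: closedI; last exact: preimage_closed.
  by apply: preimage_closed => //; exact: discrete_closed.
- apply: compact_setX; first exact: compact_set1.
  by have [_ cC _ _] := Cantor_like; apply: (subclosed_compact cV cC).
Qed.

(** The Cantor space has countably many clopen sets, and they form a base since it is compact and
    zero-dimensional; a copy in each slice [[set k]] gives the base on the codes. *)
Lemma config_code_base : exists2 W : nat -> set config_code,
  forall n, compact_clopen (W n) &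
  forall x U, nbhs x U -> exists2 n, W n x & W n `<=` U.
Proof.
have [_ cC hC zC] := Cantor_like.
have /unsquash V : $|{surjfun [set: nat] >-> @clopen Cantor}|.
  exact: (@clopen_surj R Cantor).
(* The default [(0, 0)] serves numbers that encode no pair; the set attached to them is compact open
   as well. *)
pose W n := let p := odflt (0, 0)%N (unpickle n) in [set p.1] `*` V p.2.
exists W => [n|[k c] U [[A B] [/= Ak Bc] ABU]].
  by apply: setX_clopen; exact: funS.
have [D [Dc cD] DB] := zero_dimensional_cvg hC zC cC Bc.
have [n _ VD] := @surj _ _ _ _ V _ cD.
exists (pickle (k, n)); rewrite /W pickleK/= VD//.
by move=> [i d] /= [-> Dd]; apply: ABU; split; [exact: nbhs_singleton|exact: DB].
Qed.

Lemma continuous_config_code (T : topologicalType) (f : config_code -> T) :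
  (forall k, continuous (fun c => f (k, c))) -> continuous f.
Proof.
move=> cf [k c] A /= /(cf k c) kA.
exists ([set k], [set d | A (f (k, d))]); first by split => //; exact: discrete_set1.
by move=> [i d] /= [-> ].
Qed.

Lemma compact_clopen_le (n : nat) : compact_clopen [set s : config_code | (s.1 <= n)%N].
Proof.
elim: n => [|n ih].
  rewrite (_ : [set _ | _] = [set 0%N] `*` setT); first exact/setX_clopen/clopenT.
  by apply/seteqP; split=> -[k c] /=; [rewrite leqn0 => /eqP|case=> ->].
have := compact_clopenU ih (setX_clopen n.+1 clopenT).
congr compact_clopen; apply/seteqP; split=> -[k c] /=.
  by case=> [/leqW//|[-> _]].
by rewrite leq_eqVlt ltnS => /predU1P[->|]; [right|left].
Qed.

End nat_Cantor.

(** * Integration against charges *)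

Section bounded_measurable.
Context (R : realType) d (T : measurableType d).

Definition bounded_measurable (f : T -> R) :=
  measurable_fun setT f /\ exists M : R, forall x, `|f x| <= M.

Lemma bounded_measurable_integrable (m : {measure set T -> \bar R}) (f : T -> R) :
  (m setT < +oo)%E -> bounded_measurable f -> m.-integrable setT (EFin \o f).
Proof.
move=> mfin [mf [M fM]]; apply: measurable_bounded_integrable => //.
exists M; split; first exact: num_real.
by move=> x /ltW Mx y _; exact: le_trans (fM y) Mx.
Qed.

Lemma bounded_measurableD f g : bounded_measurable f -> bounded_measurable g ->
  bounded_measurable (f \+ g).
Proof.
move=> [mf [M fM]] [mg [N gN]]; split; first exact: measurable_funD.
by exists (M + N) => x /=; rewrite (le_trans (ler_normD _ _))// lerD.
Qed.

Lemma bounded_measurableZ a f : bounded_measurable f ->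
  bounded_measurable (fun x => a * f x).
Proof.
move=> [mf [M fM]]; split; first exact: measurable_funM.
by exists (`|a| * M) => x /=; rewrite normrM ler_wpM2l.
Qed.

Lemma bounded_measurable_cst (a : R) : bounded_measurable (cst a).
Proof. by split; [exact: measurable_cst|exists `|a| => x]. Qed.

Lemma bounded_measurable_sum n (F : nat -> T -> R) :
  (forall i, bounded_measurable (F i)) ->
  bounded_measurable (fun x => \sum_(i < n) F i x).
Proof.
move=> bF; elim: n => [|n ih].
  rewrite (_ : (fun _ => _) = cst 0); first exact: bounded_measurable_cst.
  by apply/funext => x; rewrite big_ord0.
rewrite (_ : (fun _ => _) = (fun x => \sum_(i < n) F i x) \+ F n).
  exact: bounded_measurableD.
by apply/funext => x; rewrite big_ord_recr.
Qed.

Lemma Rintegral_measure_add (m1 m2 : {measure set T -> \bar R}) (f : T -> R) :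
  (m1 setT < +oo)%E -> (m2 setT < +oo)%E -> bounded_measurable f ->
  \int[measure_add m1 m2]_x f x = \int[m1]_x f x + \int[m2]_x f x.
Proof.
move=> fin1 fin2 bf.
have i1 := bounded_measurable_integrable fin1 bf.
have i2 := bounded_measurable_integrable fin2 bf.
rewrite /Rintegral [X in fine X](integral_measure_add measurableT i1 i2).
by rewrite fineD//; exact: integrable_fin_num.
Qed.

End bounded_measurable.

Lemma fin_measure_lty (R : realType) d (T : measurableType d)
  (m : {finite_measure set T -> \bar R}) : (m setT < +oo)%E.
Proof. by rewrite -ge0_fin_numE// fin_num_measure. Qed.

Lemma bounded_measurable_tensor (R : realType) d1 d2 (T1 : measurableType d1)
    (T2 : measurableType d2) (g : T1 -> R) (h : T2 -> R) :
  bounded_measurable g -> bounded_measurable h ->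
  bounded_measurable (fun p : T1 * T2 => g p.1 * h p.2).
Proof.
move=> [mg [M gM]] [mh [N hN]]; split; last first.
  by exists (M * N) => p; rewrite normrM ler_pM.
apply: measurable_funM; first exact: measurableT_comp mg measurable_fst.
exact: measurableT_comp mh measurable_snd.
Qed.

Lemma finite_product_tensor (R : realType) d1 d2 (T1 : measurableType d1)
    (T2 : measurableType d2) (m1 : {finite_measure set T1 -> \bar R})
    (m2 : {finite_measure set T2 -> \bar R}) (g : T1 -> R) (h : T2 -> R) :
  bounded_measurable g -> bounded_measurable h ->
  \int[finite_product m1 m2]_p (g p.1 * h p.2) =
  \int[m1]_x g x * \int[m2]_y h y.
Proof.
move=> bg bh.
have ig := bounded_measurable_integrable (fin_measure_lty m1) bg.
have ih := bounded_measurable_integrable (fin_measure_lty m2) bh.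
have igh := bounded_measurable_integrable
  (fin_measure_lty (finite_product m1 m2)) (bounded_measurable_tensor bg bh).
rewrite {1}/Rintegral /finite_product -integral12_prod_meas1//=.
rewrite -RintegralZr//; congr fine; apply: eq_integral => x _.
rewrite /fubini_F /=; under eq_integral do rewrite EFinM.
rewrite integralZl//= [in RHS]EFinM; congr (_ * _)%E.
by rewrite /Rintegral fineK//; exact: integrable_fin_num.
Qed.

Section charge_integral_theory.
Context (R : realType) d (T : measurableType d).
Implicit Types c : {charge set T -> \bar R}.

Lemma charge_decomp c (A : set T) : measurable A -> c A = (cpos c A - cneg c A)%E.
Proof.
by move=> mA; rewrite (jordan_decomp (hahn_posneg c) mA) /cadd/= cscaleN1.
Qed.

(** On the negative Hahn set the charge is both nonnegative and nonpositive, so the negative part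
    vanishes. This turns a point configuration, given as a charge, into a measure. *)
Lemma cpos_ge0 c (A : set T) : (forall B, measurable B -> (0 <= c B)%E) ->
  measurable A -> cpos c A = c A.
Proof.
move=> c0 mA; rewrite [RHS]charge_decomp// (_ : cneg c A = 0%E) ?sube0//.
have [_ [mN negN] _ _] := hahn_posneg c.
have mAN : measurable (A `&` hahn_neg c) by exact: measurableI.
rewrite [cneg c A]jordan_negE cjordan_negE /crestr0 mem_set// /crestr.
apply/eqP; rewrite oppe_eq0 eq_le c0// andbT.
by apply: negN => //; exact: subIsetr.
Qed.

(** Frees the integral from the Jordan decomposition: [cpos c + m2] and [m1 + cneg c] are the same
    finite measure. *)
Lemma charge_integralE c (m1 m2 : {measure set T -> \bar R}) (f : T -> R) :
  (m1 setT < +oo)%E -> (m2 setT < +oo)%E ->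
  (forall A, measurable A -> c A = (m1 A - m2 A)%E) ->
  bounded_measurable f ->
  charge_integral c f = \int[m1]_x f x - \int[m2]_x f x.
Proof.
move=> fin1 fin2 cE bf.
have finA (m : {measure set T -> \bar R}) A : measurable A ->
    (m setT < +oo)%E -> m A \is a fin_num.
  by move=> mA mT; rewrite ge0_fin_numE// (le_lt_trans _ mT)// le_measure ?inE.
have E : \int[measure_add (cpos c) m2]_x f x = \int[measure_add m1 (cneg c)]_x f x.
  congr fine; apply: eq_measure_integral => A mA _.
  rewrite -[LHS]/(measure_add (cpos c) m2 A) -[RHS]/(measure_add m1 (cneg c) A).
  rewrite !measure_addE.
  suff : (cpos c A + m2 A = m1 A + cneg c A)%E by [].
  have := cE A mA; rewrite charge_decomp//.
  have p := finA _ _ mA (fin_measure_lty (cpos c)).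
  have n := finA _ _ mA (fin_measure_lty (cneg c)).
  have m1A := finA m1 _ mA fin1; have m2A := finA m2 _ mA fin2.
  rewrite -(fineK p) -(fineK n) -(fineK m1A) -(fineK m2A) -!EFinB -!EFinD => -[pn].
  by congr (_%:E); lra.
move: E; rewrite !Rintegral_measure_add ?fin_measure_lty// /charge_integral; lra.
Qed.

Lemma charge_integralD c f g : bounded_measurable f -> bounded_measurable g ->
  charge_integral c (f \+ g) = charge_integral c f + charge_integral c g.
Proof.
move=> bf bg; rewrite /charge_integral.
rewrite !RintegralD//; try exact: bounded_measurable_integrable (fin_measure_lty _) _.
by rewrite opprD addrACA.
Qed.

Lemma charge_integralZ c a f : bounded_measurable f ->
  charge_integral c (fun x => a * f x) = a * charge_integral c f.
Proof.
move=> bf; rewrite /charge_integral.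
rewrite !RintegralZl//; try exact: bounded_measurable_integrable (fin_measure_lty _) _.
by rewrite mulrBr.
Qed.

Lemma charge_integral_sum c n (F : nat -> T -> R) :
  (forall i, bounded_measurable (F i)) ->
  charge_integral c (fun x => \sum_(i < n) F i x) =
  \sum_(i < n) charge_integral c (F i).
Proof.
move=> bF; elim: n => [|n ih].
  rewrite big_ord0 (_ : (fun _ => _) = (fun x => 0 * cst 0 x)).
    by rewrite charge_integralZ ?mul0r//; exact: bounded_measurable_cst.
  by apply/funext => x; rewrite big_ord0 mul0r.
rewrite big_ord_recr/= -ih -charge_integralD//; last exact: bounded_measurable_sum.
by congr charge_integral; apply/funext => x; rewrite big_ord_recr.
Qed.

Definition total_variation c : R := fine (cpos c setT) + fine (cneg c setT).

Lemma charge_integral_le c f (M : R) : bounded_measurable f ->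
  (forall x, `|f x| <= M) -> `|charge_integral c f| <= M * total_variation c.
Proof.
move=> bf fM.
have le (m : {finite_measure set T -> \bar R}) :
    `|\int[m]_x f x| <= M * fine (m setT).
  have mf := bounded_measurable_integrable (fin_measure_lty m) bf.
  rewrite (le_trans (le_normr_Rintegral _ mf))// -Rintegral_cst//.
  have mM : m.-integrable setT (EFin \o cst M).
    apply: bounded_measurable_integrable; first exact: fin_measure_lty.
    exact: bounded_measurable_cst.
  by apply: le_Rintegral => //; exact: (integrable_norm mf).
by rewrite (le_trans (ler_normB _ _))// mulrDr lerD.
Qed.

End charge_integral_theory.

(** By [charge_integralE] the integral may be computed from the four products of Jordan parts that
    define [charge_product], without identifying the Jordan parts of the product itself. Fubini
    factors each of the four. *)
Lemma charge_product_tensor (R : realType) d1 d2 (T1 : measurableType d1)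
    (T2 : measurableType d2) (c1 : {charge set T1 -> \bar R})
    (c2 : {charge set T2 -> \bar R}) (g : T1 -> R) (h : T2 -> R) :
  bounded_measurable g -> bounded_measurable h ->
  charge_integral (charge_product c1 c2) (fun p => g p.1 * h p.2) =
  charge_integral c1 g * charge_integral c2 h.
Proof.
move=> bg bh; have bgh := bounded_measurable_tensor bg bh.
pose pp := finite_product (cpos c1) (cpos c2).
pose nn := finite_product (cneg c1) (cneg c2).
pose pn := finite_product (cpos c1) (cneg c2).
pose np := finite_product (cneg c1) (cpos c2).
have fin := @fin_measure_lty R _ (T1 * T2)%type.
have finD (m m' : {finite_measure set (T1 * T2)%type -> \bar R}) :
    (measure_add m m' setT < +oo)%E.
  by rewrite measure_addE lte_add_pinfty ?fin.
have cE A : measurable A ->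
    charge_product c1 c2 A = (measure_add pp nn A - measure_add pn np A)%E.
  by move=> mA; rewrite !measure_addE.
rewrite (charge_integralE (finD pp nn) (finD pn np) cE bgh).
rewrite !Rintegral_measure_add ?fin// !finite_product_tensor//.
by rewrite /charge_integral; ring.
Qed.

(** * Continuous functions on compact Hausdorff spaces *)

Lemma compact_continuous_bounded (R : realType) (X : topologicalType) (f : X -> R) :
  compact [set: X] -> continuous f ->
  exists M, forall x, `|f x| <= M.
Proof.
move=> cX cf; have kf : compact (f @` setT).
  by apply: continuous_compact => //; exact: continuous_subspaceT.
have /compact_bounded [M [_ fM]] := kf.
by exists (`|M| + 1) => x; apply: fM; [rewrite ltr_pwDr// ler_norm|exists x].
Qed.

Lemma compact_Cc (R : realType) (X : topologicalType) (f : X -> R) :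
  compact [set: X] -> continuous f -> Cc R X f.
Proof.
by move=> cX cf; split => //; exact: (subclosed_compact (@closed_closure _ _) cX).
Qed.

Section compact_functions.
Context (R : realType) (X : ptopologicalType).
Hypothesis cX : compact [set: X].

Lemma continuous_bounded_measurable (f : X -> R) : continuous f ->
  bounded_measurable (f : borel X -> R).
Proof.
by move=> cf; split; [exact: continuous_borel_measurableR|exact: compact_continuous_bounded].
Qed.

Hypothesis hX : hausdorff_space X.

Lemma compact_urysohn (A B : set X) : closed A -> closed B -> A `&` B = set0 ->
  exists f : X -> R, [/\ continuous f, forall x, 0 <= f x <= 1,
    forall x, A x -> f x = 0 & forall x, B x -> f x = 1].
Proof.
move=> cA cB AB0.
have /(@normal_separatorP R)/(_ A B cA cB AB0) := compact_normal hX cX.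
move=> /(@uniform_separatorP _ R)[f [cf f01 fA fB]]; exists f; split => //.
- move=> x; have : range f (f x) by exists x.
  by move=> /f01 /=; rewrite in_itv.
- by move=> x Ax; apply: fA; exists x.
- by move=> x Bx; apply: fB; exists x.
Qed.

(* A partition of unity subordinate to a cover by sets on which all the
   sections [f (_, y)] oscillate by at most [e]. *)
Lemma tensor_approximation (f : X * X -> R) (e : R) : continuous f -> 0 < e ->
  exists (n : nat) (g h : nat -> X -> R),
    [/\ forall i, continuous (g i), forall i, continuous (h i) &
        forall x y, `|f (x, y) - \sum_(i < n) g i x * h i y| <= e].
Proof.
move=> cf e0; have e20 : 0 < e / 2 by rewrite divr_gt0.
have tube a : exists2 U : set X, open U /\ U a &
    forall x y, U x -> `|f (x, y) - f (a, y)| <= e.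
  pose V : set X := fun x => [set: X] `<=` (fun y => `|f (x, y) - f (a, y)| <= e).
  suff aV : nbhs a V.
    exists V^°; first by split; [exact: open_interior|exact: nbhs_singleton (nbhs_interior aV)].
    by move=> x y /interior_subset; apply.
  (* The tube lemma: control near each point [(a, y)] becomes uniform in [y] by compactness. Two
     differences of at most [e / 2] are added. *)
  apply: (iffLR (@compact_near_coveringP _ _) cX X (nbhs a)) => y _.
  have /cvgrPdist_lt/(_ _ e20) := @cf (a, y).
  move=> [[A B] /= [aA yB] AB]; exists (B, A) => // -[y' x'] [/= By' Ax'].
  have f1 := AB (x', y') (conj Ax' By').
  have f2 := AB (a, y') (conj (nbhs_singleton aA) By').
  rewrite (_ : _ - _ = (f (a, y) - f (a, y')) - (f (a, y) - f (x', y'))).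
    by rewrite (le_trans (ler_normB _ _))// (splitr e) lerD// ltW.
  by lra.
pose U a := s2val (cid2 (tube a)).
have oU a : open (U a) by have [] := s2valP (cid2 (tube a)).
have Ua a : U a a by have [] := s2valP (cid2 (tube a)).
have fU a x y : U a x -> `|f (x, y) - f (a, y)| <= e.
  exact: (s2valP' (cid2 (tube a))).
have bump a : exists b : X -> R, [/\ continuous b, forall x, 0 <= b x,
    b a = 1 & forall x, ~ U a x -> b x = 0].
  have [|||b [cb b01 b0 b1]] := @compact_urysohn (~` U a) [set a].
  - exact: open_closedC.
  - exact/accessible_closed_set1/hausdorff_accessible.
  - by rewrite -subset0 => x [Ux /= xa]; apply: Ux; rewrite xa.
  - exists b; split => //; last exact: b1.
    by move=> x; case/andP: (b01 x).
pose b a := projT1 (cid (bump a)).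
have cb a : continuous (b a) by case: (projT2 (cid (bump a))).
have b0 a x : 0 <= b a x by case: (projT2 (cid (bump a))) => _ + _ _; apply.
have ba a : b a a = 1 by case: (projT2 (cid (bump a))).
have bU a x : ~ U a x -> b a x = 0.
  by case: (projT2 (cid (bump a))) => _ _ _; apply.
have := cX; rewrite compact_cover => /(_ X setT (fun a => [set x | 0 < b a x])).
case=> [a _|x _|D _ bD].
- by apply: (@open_comp _ _ (b a) [set r | 0 < r]) => [x _|]; [exact: cb|exact: open_gt].
- by exists x => //=; rewrite ba.
pose s := finmap.enum_fset D.
pose S x := \sum_(i < size s) b (nth point s i) x.
have S0 x : 0 < S x.
  have [a /= aD bax] := bD x I.
  have ia : (index a s < size s)%N by rewrite index_mem.
  rewrite /S (bigD1 (Ordinal ia))//= nth_index// ltr_wpDr//.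
  exact: sumr_ge0.
have cS : continuous S.
  move=> x; rewrite /S; apply: cvg_big => [|i _]; last exact: cb.
  by apply: add_continuous.
exists (size s), (fun i x => b (nth point s i) x / S x), (fun i y => f (nth point s i, y)).
split=> [i x|i y|x y].
- by apply: cvgM; [exact: cb|apply: cvgV; [rewrite gt_eqF|exact: cS]].
- apply: (@continuous_comp _ _ _ (fun y => (nth point s i, y)) f); last exact: cf.
  by apply: cvg_pair; [exact: cvg_cst|exact: cvg_id].
have -> : f (x, y) = \sum_(i < size s) b (nth point s i) x / S x * f (x, y).
  by rewrite -mulr_suml -mulr_suml -/(S x) divff ?gt_eqF// mul1r.
rewrite -sumrB (le_trans (ler_norm_sum _ _ _))//.
have -> : e = \sum_(i < size s) b (nth point s i) x / S x * e.
  by rewrite -mulr_suml -mulr_suml -/(S x) divff ?gt_eqF// mul1r.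
apply: ler_sum => i _; rewrite -mulrBr normrM ger0_norm; last first.
  by rewrite divr_ge0// ltW.
have [Ux|Ux] := pselect (U (nth point s i) x).
  by rewrite ler_wpM2l ?fU// divr_ge0// ltW.
by rewrite bU// !mul0r.
Qed.

End compact_functions.

(** * Continuity and measurability of the pairings for the vague topology *)

Section vague.
Context (R : realType) (X : ptopologicalType).

Lemma pair1_continuous (f : X -> R) : Cc R X f ->
  continuous (pair1 f : srm R X -> R).
Proof.
move=> Ccf eta; pose F : Cc R X := exist _ f (mem_set Ccf).
have /cvg_sup/(_ F) etaF : nbhs eta --> (eta : vague_topology R X) by [].
move=> V nV; apply: (etaF (pair1 f @^-1` V)).
exact: (@initial_continuous _ _ (fun eta : srm R X => charge_integral eta f)).
Qed.

Lemma vague_continuous (S : topologicalType) (t : S -> srm R X) :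
  (forall f, Cc R X f -> continuous (fun s => pair1 f (t s))) -> continuous t.
Proof.
move=> ct s; apply/cvg_sup => -[f Ff].
apply: continuous_comp_initial s => s.
exact: (ct f (set_mem Ff)).
Qed.

Hypothesis cX : compact [set: X].
Hypothesis hX : hausdorff_space X.

(** Serves twice. It makes a continuous [f] measurable for the product of the Borel sigma-algebras,
    over which [charge_product] integrates, and it exhibits [pair2 f] as a pointwise limit of
    polynomials in the continuous maps [pair1]. *)
Lemma continuous_tensor_limit (f : X * X -> R) : continuous f ->
  exists (N : nat -> nat) (g h : nat -> nat -> X -> R),
    [/\ forall n i, continuous (g n i), forall n i, continuous (h n i) &
        forall n x y, `|f (x, y) - \sum_(i < N n) g n i x * h n i y| <= n.+1%:R^-1].
Proof.
move=> cf; have n0 n : 0 < n.+1%:R^-1 :> R by rewrite invr_gt0.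
have /choice[p pP] n : exists p : nat * (nat -> X -> R) * (nat -> X -> R),
    [/\ forall i, continuous (p.1.2 i), forall i, continuous (p.2 i) &
     forall x y,
       `|f (x, y) - \sum_(i < p.1.1) p.1.2 i x * p.2 i y| <= n.+1%:R^-1].
  by have [m [g [h gh]]] := tensor_approximation cX hX cf (n0 n); exists (m, g, h).
exists (fun n => (p n).1.1), (fun n => (p n).1.2), (fun n => (p n).2).
by split=> n; case: (pP n).
Qed.

Lemma bounded_measurable_tensor_sum n (g h : nat -> X -> R) :
  (forall i, continuous (g i)) -> (forall i, continuous (h i)) ->
  bounded_measurable
    (fun p : borel X * borel X => \sum_(i < n) g i p.1 * h i p.2).
Proof.
move=> cg ch; apply: (@bounded_measurable_sum _ _ (borel X * borel X)%type n
  (fun i p => g i p.1 * h i p.2)) => i.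
apply: bounded_measurable_tensor; exact: continuous_bounded_measurable.
Qed.

Lemma cvg_le_invn (l : R) (u : nat -> R) (K : R) :
  (forall n, `|l - u n| <= n.+1%:R^-1 * K) -> u @ \oo --> l.
Proof.
move=> uK; apply/cvgrPdist_lt => e e0.
have K0 : 0 < `|K| + 1 by rewrite ltr_wpDl.
near=> n; rewrite (le_lt_trans (uK n))//.
rewrite (@le_lt_trans _ _ (n.+1%:R^-1 * (`|K| + 1)))//.
  by rewrite ler_pM2l ?invr_gt0// (le_trans (ler_norm K))// lerDl.
rewrite -ltr_pdivlMr//; near: n.
exact: (near_infty_natSinv_lt (PosNum (divr_gt0 e0 K0))).
Unshelve. all: by end_near. Qed.

Lemma continuous2_bounded_measurable (f : X * X -> R) : continuous f ->
  bounded_measurable (f : borel X * borel X -> R).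
Proof.
move=> cf; have [N [g [h [cg ch fgh]]]] := continuous_tensor_limit cf; split.
  apply: (@measurable_fun_cvg _ _ _ setT
    (fun n (p : borel X * borel X) => \sum_(i < N n) g n i p.1 * h n i p.2)).
    by move=> n; case: (bounded_measurable_tensor_sum (N n) (cg n) (ch n)).
  move=> -[x y] _; apply: (@cvg_le_invn _ _ 1) => n.
  by rewrite mulr1; exact: fgh.
have cXX : compact [set: X * X] by rewrite -setXTT; exact: compact_setX.
by have [M fM] := compact_continuous_bounded cXX cf; exists M.
Qed.

Lemma pair2_tensor_sum n (g h : nat -> X -> R) (eta : srm R X) :
  (forall i, continuous (g i)) -> (forall i, continuous (h i)) ->
  pair2 (fun p => \sum_(i < n) g i p.1 * h i p.2) eta =
  \sum_(i < n) pair1 (g i) eta * pair1 (h i) eta.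
Proof.
move=> cg ch; rewrite /pair2.
rewrite (@charge_integral_sum _ _ (borel X * borel X)%type _ n
  (fun i p => g i p.1 * h i p.2)); last first.
  move=> i; apply: bounded_measurable_tensor; exact: continuous_bounded_measurable.
apply: eq_bigr => i _.
by rewrite charge_product_tensor//; exact: continuous_bounded_measurable.
Qed.

Lemma pair2_limit (f : X * X -> R) (N : nat -> nat) (g h : nat -> nat -> X -> R)
    (eta : srm R X) :
  continuous f ->
  (forall n i, continuous (g n i)) -> (forall n i, continuous (h n i)) ->
  (forall n x y, `|f (x, y) - \sum_(i < N n) g n i x * h n i y| <= n.+1%:R^-1) ->
  (fun n => \sum_(i < N n) pair1 (g n i) eta * pair1 (h n i) eta) @ \oo -->
    pair2 f eta.
Proof.
move=> cf cg ch fgh.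
apply: (@cvg_le_invn _ _ (total_variation (charge_product eta eta))) => n.
rewrite -(pair2_tensor_sum _ _ (cg n) (ch n)).
have bf := continuous2_bounded_measurable cf.
have bs := bounded_measurable_tensor_sum (N n) (cg n) (ch n).
have bsN := bounded_measurableZ (-1) bs.
have -> : pair2 f eta - pair2 (fun p => \sum_(i < N n) g n i p.1 * h n i p.2) eta
    = charge_integral (charge_product eta eta)
      (f \+ (fun p => -1 * \sum_(i < N n) g n i p.1 * h n i p.2)).
  by rewrite (charge_integralD _ bf bsN) (charge_integralZ _ _ bs) mulN1r.
apply: charge_integral_le; first exact: (bounded_measurableD bf bsN).
by move=> [x y]; rewrite /= mulN1r; exact: fgh.
Qed.

Lemma pair1_measurable (f : X -> R) : continuous f ->
  measurable_fun setT (pair1 f : borel (srm R X) -> R).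
Proof.
move=> cf; apply: continuous_borel_measurableR.
by apply: pair1_continuous; exact: compact_Cc.
Qed.

Lemma pair2_measurable (f : X * X -> R) : continuous f ->
  measurable_fun setT (pair2 f : borel (srm R X) -> R).
Proof.
move=> cf; have [N [g [h [cg ch fgh]]]] := continuous_tensor_limit cf.
apply: (@measurable_fun_cvg _ _ _ setT
  (fun n (eta : borel (srm R X)) => \sum_(i < N n) pair1 (g n i) eta * pair1 (h n i) eta)).
  move=> n; apply: measurable_sum => i.
  by apply: measurable_funM; exact: pair1_measurable.
by move=> eta _; exact: pair2_limit.
Qed.

Lemma pair3_cst1 (eta : srm R X) : pair3 (cst 1) eta = pair1 (cst 1) eta ^+ 3.
Proof.
have b1 := bounded_measurable_cst (borel X) (1 : R).
have b2 := bounded_measurable_cst (borel X * borel X)%type (1 : R).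
have E2 : charge_integral (charge_product eta eta) (cst 1) = pair1 (cst 1) eta ^+ 2.
  rewrite expr2 /pair1 -(@charge_product_tensor _ _ _ (borel X) (borel X))//.
  by congr charge_integral; apply/funext => p; rewrite mulr1.
rewrite exprSr -E2 /pair1 -(@charge_product_tensor _ _ _ (borel X * borel X)%type (borel X))//.
by congr charge_integral; apply/funext => p; rewrite mulr1.
Qed.

Lemma quadratic_measurable f0 (f1 : X -> R) (f2 : X * X -> R) :
  continuous f1 -> continuous f2 ->
  measurable_fun setT (quadratic f0 f1 f2 : borel (srm R X) -> R).
Proof.
move=> c1 c2; apply: measurable_funD; last exact: pair2_measurable.
by apply: measurable_funD => //; exact: pair1_measurable.
Qed.

End vague.

(** * Continuous functions separate measures *)

Section borel_measure_eq.
Context (R : realType) (X : ptopologicalType).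
Hypothesis cX : compact [set: X].
Hypothesis hX : hausdorff_space X.
Hypothesis sX : @second_countable X.

(** By regularity, [U] is the union of the closures of basic open sets that it contains. The [n]-th
    function is a Urysohn function, [1] on the first [n] of these closures and [0] off [U]. *)
Lemma open_indicator_limit (U : set X) : open U ->
  exists f : nat -> X -> R, [/\ forall n, continuous (f n),
    forall n x, 0 <= f n x <= 1 & forall x, f ^~ x @ \oo --> (\1_U x : R)].
Proof.
move=> oU; have [V oV Vbase] := second_countable_base sX.
pose C i := if `[< closure (V i) `<=` U >] then closure (V i) else set0.
pose D n := \big[setU/set0]_(i < n) C i.
have cC i : closed (C i).
  by rewrite /C; case: ifP => _; [exact: closed_closure|exact: closed0].
have CU i : C i `<=` U by move=> x; rewrite /C; case: ifPn => [/asboolP|//]; apply.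
have cD n : closed (D n).
  rewrite /D; elim/big_ind : _ => //; first exact: closed0.
  by move=> ? ? ? ?; exact: closedU.
have DU n : D n `<=` U.
  by rewrite /D -bigcup_mkord; apply: bigcup_sub => i _; exact: CU.
have /choice[f fP] n : exists f : X -> R, [/\ continuous f, forall x, 0 <= f x <= 1,
    forall x, (~` U) x -> f x = 0 & forall x, D n x -> f x = 1].
  apply: compact_urysohn => //; first exact: open_closedC.
  by rewrite -subset0 => x [Ux /DU].
have cf n : continuous (f n) by case: (fP n).
have f01 n x : 0 <= f n x <= 1 by case: (fP n) => _ + _ _; apply.
exists f; split=> // x.
have [Ux|Ux] := pselect (U x); last first.
  rewrite indicE memNset// (_ : f ^~ x = cst 0); first exact: cvg_cst.
  by apply/funext => n; case: (fP n) => _ _ + _; apply.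
have [i Cx] : exists i, C i x.
  have := compact_regular hX cX (@filterT _ (nbhs x) (nbhs_filter x)).
  move=> /(_ U (open_nbhs_nbhs (conj oU Ux)))[B xB BU].
  have [i Vx VB] := Vbase x B xB; exists i; rewrite /C ifT.
    exact: subset_closure.
  by apply/asboolP => y /(closureS VB)/BU.
rewrite indicE mem_set//; apply: cvg_near_cst; near=> n.
case: (fP n) => _ _ _; apply; rewrite /D -bigcup_mkord; exists i => //=.
by near: n; exact: nbhs_infty_gt.
Unshelve. all: by end_near. Qed.

(** Open sets are stable under intersection and generate the Borel sets; on them the measures agree
    by dominated convergence. *)
Lemma borel_measure_eq (m1 m2 : {measure set (borel X) -> \bar R}) :
  (m1 setT < +oo)%E -> (m2 setT < +oo)%E ->
  (forall f : X -> R, continuous f ->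
    (\int[m1]_x (f x)%:E = \int[m2]_x (f x)%:E)%E) ->
  forall A, measurable A -> m1 A = m2 A.
Proof.
move=> fin1 fin2 m12 A mA.
apply: (@measure_unique _ R (borel X) (@open X) (fun=> setT) erefl) => //.
- exact: openI.
- by move=> _; exact: openT.
- by rewrite bigcup_const.
move=> {mA}A oA; have [f [cf f01 fA]] := open_indicator_limit oA.
have lim (m : {measure set (borel X) -> \bar R}) : (m setT < +oo)%E ->
    (fun n => \int[m]_x (f n x)%:E)%E @ \oo --> m A.
  move=> fin; have mA : measurable (A : set (borel X)) by exact: open_borel_measurable.
  have -> : m A = (\int[m]_x (\1_A x)%:E)%E by rewrite integral_indic// setIT.
  have i1 : m.-integrable setT (EFin \o cst 1).
    exact: bounded_measurable_integrable fin (bounded_measurable_cst _ _).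
  apply: (@dominated_cvg _ _ _ m setT measurableT _ _ (EFin \o cst 1)) => //.
  - by move=> n; apply/measurable_EFinP; exact: continuous_borel_measurableR.
  - by move=> x _; apply/cvg_EFin; [exact: nearW|exact: fA].
  - move=> n x _; rewrite lee_fin.
    by have /andP[f0 f1] := f01 n x; rewrite ger0_norm.
have := lim m2 fin2; under eq_fun do rewrite -m12//.
by move=> /cvg_lim <-//; apply/esym/cvg_lim => //; exact: lim.
Qed.

(** Moving the negative parts across turns equality of charges into equality of two measures, to
    which [borel_measure_eq] applies. *)
Lemma srm_separated (eta1 eta2 : srm R X) :
  (forall f, Cc R X f -> pair1 f eta1 = pair1 f eta2) -> eta1 = eta2.
Proof.
move=> eta12; apply: srm_eq => A mA.
have fin := @fin_measure_lty R _ (borel X).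
have finD (m m' : {finite_measure set (borel X) -> \bar R}) :
    (measure_add m m' setT < +oo)%E.
  by rewrite measure_addE lte_add_pinfty ?fin.
have E : measure_add (cpos eta1) (cneg eta2) A =
    measure_add (cpos eta2) (cneg eta1) A.
  apply: borel_measure_eq => //; [exact: finD|exact: finD|move=> f cf].
  have bf := continuous_bounded_measurable cX cf.
  have i m := bounded_measurable_integrable (fin m) bf.
  rewrite !(integral_measure_add measurableT (i _) (i _)).
  have := eta12 f (compact_Cc cX cf); rewrite /pair1 /charge_integral /Rintegral.
  have fi m := integrable_fin_num measurableT (i m).
  rewrite -(fineK (fi (cpos eta1))) -(fineK (fi (cpos eta2))).
  rewrite -(fineK (fi (cneg eta1))) -(fineK (fi (cneg eta2))) -!EFinD/= => E.
  by congr EFin; lra.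
have fA (m : {finite_measure set (borel X) -> \bar R}) : m A \is a fin_num.
  exact: fin_num_measure.
have {}E : (cpos eta1 A + cneg eta2 A = cpos eta2 A + cneg eta1 A)%E.
  by move: E; rewrite !measure_addE.
move: E; rewrite !charge_decomp// -(fineK (fA (cpos eta1))) -(fineK (fA (cpos eta2))).
rewrite -(fineK (fA (cneg eta1))) -(fineK (fA (cneg eta2))) -!EFinB -!EFinD.
by move=> -[E]; congr EFin; lra.
Qed.

(** Needed so that compact sets of signed measures are closed, hence Borel. *)
Lemma srm_hausdorff : hausdorff_space (srm R X).
Proof.
rewrite open_hausdorff => eta1 eta2 eta12.
have [f [Cf f12]] : exists f, Cc R X f /\ pair1 f eta1 != pair1 f eta2.
  apply: contrapT => /forallNP H; move/eqP : eta12; apply; apply: srm_separated => f Cf.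
  by apply/eqP/negPn/negP => f12; exact: (H f).
have := @Rhausdorff R; rewrite open_hausdorff => /(_ _ _ f12)[[A B]] /=.
rewrite !inE => -[A1 B2] [oA oB AB0].
exists (pair1 f @^-1` A, pair1 f @^-1` B); first by rewrite /= !inE.
split => /=.
- by apply: open_comp => // eta _; exact: pair1_continuous.
- by apply: open_comp => // eta _; exact: pair1_continuous.
- by apply/eqP; rewrite -preimage_setI AB0 preimage_set0.
Qed.

End borel_measure_eq.

(** * Point configurations *)

Section config_measure.
Context (R : realType) (X : ptopologicalType) (k : nat) (x : nat -> X).

Definition config_measure : set (borel X) -> \bar R :=
  msum (fun i => dirac (x i : borel X)) k.

HB.instance Definition _ := Measure.on config_measure.

Lemma config_measureE (A : set (borel X)) :
  config_measure A = (\sum_(i < k) \1_A (x i))%:E.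
Proof. by rewrite /config_measure /msum -sumEFin. Qed.

Let config_measure_fin : fin_num_fun config_measure.
Proof. by move=> A mA; rewrite config_measureE. Qed.

HB.instance Definition _ :=
  @Measure_isFinite.Build _ _ _ config_measure config_measure_fin.

Lemma config_measure_radon : radon config_measure.
Proof.
split=> [y|A mA].
  by exists setT; split; [exact: openT|by []|rewrite config_measureE ltry].
apply/eqP; rewrite eq_le; apply/andP; split.
  (* The atoms lying in [A] form a finite, hence compact, set that carries the whole mass of [A]. *)
  apply: ereal_sup_ubound; exists (A `&` [set x i | i in `I_k]); last first.
    rewrite !config_measureE; congr EFin; apply: eq_bigr => i _.
    have xi : x i \in [set x i | i in `I_k].
      by rewrite inE; exists i => //=; exact: ltn_ord.
    by rewrite !indicE in_setI xi andbT.
  split; last exact: subIsetl.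
  apply: finite_compact; apply: sub_finite_set (@subIsetr _ _ _) _.
  exact/finite_image/finite_II.
apply: ge_ereal_sup => _ [K [_ KA] <-]; rewrite !config_measureE lee_fin.
apply: ler_sum => i _; rewrite !indicE ler_nat.
by have [/set_mem/KA/mem_set ->|] := boolP (x i \in K).
Qed.

(** Restriction to the full set changes nothing on Borel sets, but [crestr0] gives the value [0]
    elsewhere, as [srm_out] demands. *)
Definition config_charge : {charge set (borel X) -> \bar R} :=
  crestr0 (charge_of_finite_measure config_measure) (@measurableT _ (borel X)).

Lemma config_chargeE (A : set (borel X)) : measurable A ->
  config_charge A = config_measure A.
Proof.
by move=> mA; rewrite /= /crestr0 /crestr mem_set// setIT.
Qed.

Lemma config_charge_out (A : set (borel X)) : ~ measurable A ->
  config_charge A = 0%E.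
Proof. by move=> mA; rewrite /= /crestr0 memNset. Qed.

Lemma config_charge_radon : exists mu1 mu2 : {finite_measure set (borel X) -> \bar R},
  [/\ radon mu1, radon mu2 & forall A : set (borel X), measurable A ->
      config_charge A = (mu1 A - mu2 A)%E].
Proof.
exists config_measure, mzero.
split; [exact: config_measure_radon|exact: radon_mzero|move=> A mA].
by rewrite config_chargeE// /mzero sube0.
Qed.

Definition config : srm R X :=
  SRM config_charge_radon config_charge_out.

Lemma point_config_config : point_config R X config.
Proof.
move=> A mA; rewrite /config/= config_chargeE// config_measureE.
exists (\sum_(i < k) (x i \in A))%N; congr EFin; rewrite natr_sum.
by apply: eq_bigr => i _; rewrite indicE.
Qed.

End config_measure.

Section config_integral.
Context (R : realType) (X : ptopologicalType) (x : nat -> X).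

Lemma Rintegral_config_measure k (f : borel X -> R) : bounded_measurable f ->
  \int[config_measure R k x]_y f y = \sum_(i < k) f (x i).
Proof.
move=> bf; elim: k => [|k ih].
  rewrite big_ord0 /Rintegral (eq_measure_integral mzero).
    by rewrite integral_measure_zero.
  by move=> A mA _; rewrite [LHS]config_measureE big_ord0.
rewrite big_ord_recr/= -ih -[f (x k)]/(fine (f (x k))%:E).
have -> : (f (x k))%:E = (\int[dirac (x k : borel X)]_y (f y)%:E)%E.
  rewrite integral_dirac// ?diracT ?mul1e//.
  by apply/measurable_EFinP; case: bf.
rewrite -/(Rintegral _ _ _) -Rintegral_measure_add//; last 2 first.
- exact: fin_measure_lty.
- by rewrite /= diracT ltry.
congr fine; apply: eq_measure_integral => A mA _.
rewrite [LHS]config_measureE [RHS]measure_addE big_ord_recr/= EFinD.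
by rewrite [X in (_ = X + _)%E]config_measureE.
Qed.

Lemma pair1_config k (f : X -> R) : compact [set: X] -> continuous f ->
  pair1 f (config R k x) = \sum_(i < k) f (x i).
Proof.
move=> cX cf; have bf := continuous_bounded_measurable cX cf.
rewrite /pair1 (@charge_integralE _ _ _ _ (config_measure R k x) mzero)//.
- rewrite Rintegral_config_measure// [X in _ - X](_ : _ = 0) ?subr0//.
  by rewrite /Rintegral integral_measure_zero.
- exact: fin_measure_lty.
- exact: (@fin_measure_lty R _ (borel X) mzero).
- by move=> A mA; rewrite /config/= config_chargeE// /mzero sube0.
Qed.

(** On tensor sums the pairing is a product of two single sums. In the limit, each of the [k ^ 2]
    terms of the double sum is off by at most [1 / (n + 1)]. *)
Lemma pair2_config k (f : X * X -> R) : compact [set: X] -> hausdorff_space X ->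
  continuous f ->
  pair2 f (config R k x) = \sum_(i < k) \sum_(j < k) f (x i, x j).
Proof.
move=> cX hX cf; have [N [g [h [cg ch fgh]]]] := continuous_tensor_limit cX hX cf.
have /cvg_lim <-// := pair2_limit (eta := config R k x) cX hX cf cg ch fgh.
apply/cvg_lim => //; apply: (@cvg_le_invn _ _ _ (k%:R * k%:R)) => n.
have -> : \sum_(l < N n) pair1 (g n l) (config R k x) * pair1 (h n l) (config R k x) =
    \sum_(i < k) \sum_(j < k) \sum_(l < N n) g n l (x i) * h n l (x j).
  under eq_bigr do rewrite !pair1_config// mulr_suml.
  rewrite exchange_big; apply: eq_bigr => i _.
  under eq_bigr do rewrite mulr_sumr.
  by rewrite exchange_big.
rewrite -sumrB (le_trans (ler_norm_sum _ _ _))//.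
rewrite (@le_trans _ _ (\sum_(i < k) (n.+1%:R^-1 * k%:R)))//; last first.
  by rewrite sumr_const card_ord -[leLHS]mulr_natr mulrA.
apply: ler_sum => i _; rewrite -sumrB (le_trans (ler_norm_sum _ _ _))//.
rewrite (@le_trans _ _ (\sum_(j < k) n.+1%:R^-1))//; last first.
  by rewrite sumr_const card_ord -[leLHS]mulr_natr.
by apply: ler_sum => j _; exact: fgh.
Qed.

Lemma pair3_config k : compact [set: X] ->
  pair3 (cst 1) (config R k x) = k%:R ^+ 3.
Proof.
move=> cX; rewrite pair3_cst1 pair1_config//; last exact: cst_continuous.
by rewrite sumr_const card_ord.
Qed.

End config_integral.

(** * Integer-valued measures are finite sums of point masses *)

Section atoms.
Context (R : realType) (X : ptopologicalType).
Hypothesis hX : hausdorff_space X.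
Hypothesis sX : @second_countable X.

Let mset1 (x : X) : measurable ([set x] : set (borel X)).
Proof.
apply: closed_borel_measurable.
exact/accessible_closed_set1/hausdorff_accessible.
Qed.

Let null_bigcup (mu : {measure set (borel X) -> \bar R}) (P : set nat)
    (F : nat -> set (borel X)) :
  (forall i, measurable (F i)) -> (forall i, P i -> mu (F i) = 0%E) ->
  mu (\bigcup_(i in P) F i) = 0%E.
Proof.
move=> mF F0; pose G i := if i \in P then F i else set0.
have mG i : measurable (G i) by rewrite /G; case: ifP.
have -> : \bigcup_(i in P) F i = \bigcup_i G i by rewrite bigcup_mkcond.
apply/eqP; rewrite eq_le measure_ge0 andbT.
rewrite (le_trans (measure_sigma_subadditive mu mG _ (@subset_refl _ _)))//.
  exact: bigcup_measurable.
rewrite eseries0// => i _ _; rewrite /G; case: ifPn => [/set_mem/F0//|_].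
exact: measure0.
Qed.

Definition nat_valued (mu : set (borel X) -> \bar R) :=
  forall A, measurable A -> exists n : nat, mu A = n%:R%:E.

(* A base neighbourhood [V] of [x] of least measure loses only null sets when
   it is intersected with another base neighbourhood, hence [mu V = mu [set x]]. *)
Lemma nat_valued_atom (mu : {measure set (borel X) -> \bar R}) :
  nat_valued mu -> mu setT != 0%E -> exists x, (1 <= mu [set x])%E.
Proof.
move=> nat_mu muT; have [V oV Vbase] := second_countable_base sX.
have mV i : measurable (V i : set (borel X)) by exact: open_borel_measurable.
(* A point of the support: if every point had a null basic neighbourhood, countably many null sets
   would cover [X]. *)
have [x xV] : exists x, forall i, V i x -> mu (V i) != 0%E.
  apply: contrapT => /forallNP nV; move/eqP : muT; apply.
  have -> : [set: borel X] = \bigcup_(i in [set i | mu (V i) = 0%E]) V i.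
    apply/seteqP; split=> // x _; have /existsNP[i /not_implyP[Vx V0]] := nV x.
    by exists i => //=; exact/eqP/negPn/negP.
  exact: null_bigcup.
have /choice[n nE] i := nat_mu (V i) (mV i).
have [i Vix imin] : exists2 i, V i x & forall j, V j x -> (n i <= n j)%N.
  have ex : exists m, `[< exists2 i, V i x & n i = m >].
    have [i Vx _] := Vbase x setT filterT.
    by exists (n i); apply/asboolP; exists i.
  case: (ex_minnP ex) => m /asboolP[i Vx nm] mmin.
  by exists i => // j Vjx; rewrite nm; apply: mmin; apply/asboolP; exists j.
exists x; have ViE : mu (V i `\` [set x]) = 0%E.
  have -> : V i `\` [set x] = \bigcup_(j in [set j | V j x]) (V i `\` V j).
    apply/seteqP; split=> [y [Viy yx]|y [j /= Vjx [Viy Vjy]]]; last first.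
      by split => // yx; apply: Vjy; rewrite yx.
    have [j Vjx jy] : exists2 j, V j x & V j `<=` ~` [set y].
      apply: Vbase; apply: open_nbhs_nbhs; split; last by move=> /esym.
      by apply: closed_openC; exact/accessible_closed_set1/hausdorff_accessible.
    by exists j => //; split => // /jy; apply.
  apply: null_bigcup => [j|j /= Vjx]; first exact: measurableD.
  have [l Vlx lij] : exists2 l, V l x & V l `<=` V i `&` V j.
    by apply: Vbase; apply: filterI; apply: open_nbhs_nbhs.
  have mij : measurable (V i `&` V j : set (borel X)) by exact: measurableI.
  have [m mE] := nat_mu _ mij.
  have [d dE] := nat_mu _ (measurableD (mV i) (mV j)).
  have : mu (V i) = (mu (V i `&` V j) + mu (V i `\` V j))%E.
    by rewrite addeC -measureDI.
  rewrite mE dE nE -EFinD -natrD => -[/eqP]; rewrite eqr_nat => /eqP nmd.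
  have : (mu (V l) <= mu (V i `&` V j))%E by rewrite le_measure ?inE.
  rewrite nE mE lee_fin ler_nat => lm.
  have := imin l Vlx; rewrite nmd => ml.
  have -> : d = 0%N by apply/eqP; rewrite -leqn0 -(leq_add2l m) addn0 (leq_trans ml).
  by [].
have xVi : [set x] `<=` V i by move=> _ ->.
have : mu (V i) = (mu (V i `\` [set x]) + mu (V i `&` [set x]))%E.
  exact: (measureDI mu (mV i) (mset1 x)).
rewrite ViE (setIidr xVi) add0e => <-; rewrite nE lee_fin ler1n lt0n.
by have := xV i Vix; rewrite nE; apply: contra_neq => ->.
Qed.

(** Induction on the total mass, removing one atom [a] at a time. The difference with the Dirac mass
    is formed as a charge; it is nonnegative because every Borel set containing [a] has mass at
    least [1], so [cpos] gives it back as a measure. *)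
Lemma nat_valued_config (k : nat) (mu : {finite_measure set (borel X) -> \bar R}) :
  nat_valued mu -> mu setT = k%:R%:E ->
  exists x : nat -> X, forall A, measurable A -> mu A = config_measure R k x A.
Proof.
elim: k mu => [|k ih] mu nat_mu muT.
  exists (fun=> point) => A mA; rewrite config_measureE big_ord0.
  apply/eqP; rewrite eq_le measure_ge0 andbT -[leRHS]muT.
  by rewrite le_measure ?inE.
have muT0 : mu setT != 0%E by rewrite muT eqe pnatr_eq0.
have [a a1] := nat_valued_atom nat_mu muT0.
pose c := cadd (charge_of_finite_measure mu)
  (copp (charge_of_finite_measure (dirac (a : borel X)))).
have cE A : c A = (mu A - (\1_A a)%:E)%E by [].
have nat_c A : measurable A -> exists n : nat, c A = n%:R%:E.
  move=> mA; have [n nE] := nat_mu A mA; rewrite cE nE indicE.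
  case: (boolP (a \in A)) => [/set_mem aA|_]; last by exists n; rewrite sube0.
  have : (1 <= mu A)%E.
    by rewrite (le_trans a1)// le_measure ?inE// => _ ->.
  rewrite nE lee_fin ler1n; case: n {nE} => // n _; exists n.
  by rewrite -EFinB -natr1 addrK.
have cposE A : measurable A -> cpos c A = c A.
  by apply: cpos_ge0 => B /nat_c[n cB]; rewrite [leRHS]cB lee_fin.
have [||x xE] := ih (cpos c).
- by move=> A mA; rewrite cposE//; exact: nat_c.
- by rewrite cposE// cE muT indicT -EFinB -natr1 addrK.
exists (fun i => if i == k then a else x i) => A mA.
have := xE A mA; rewrite cposE// cE !config_measureE big_ord_recr/= eqxx EFinD.
have -> : \sum_(i < k) \1_A (if i == k :> nat then a else x i) =
    \sum_(i < k) \1_A (x i) :> R.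
  by apply: eq_bigr => i _; rewrite ltn_eqF.
by move=> <-; rewrite EFinN subeK.
Qed.

Lemma point_configP (eta : srm R X) :
  point_config R X eta <-> exists k x, eta = config R k x.
Proof.
split=> [nat_eta|[k [x ->]]]; last exact: point_config_config.
have etaE A : measurable A -> cpos eta A = eta A.
  by apply: cpos_ge0 => B /nat_eta[n etaB]; rewrite [leRHS]etaB lee_fin.
have [k kE] := nat_eta _ measurableT.
have [||x xE] := @nat_valued_config k (cpos eta).
- by move=> A mA; rewrite etaE//; exact: nat_eta.
- by rewrite etaE.
exists k, x; apply: srm_eq => A mA.
by rewrite -etaE// xE//= config_chargeE.
Qed.

End atoms.

Lemma continuous_sum (R : realType) (S : topologicalType) n (F : nat -> S -> R) :
  (forall i, continuous (F i)) -> continuous (fun s => \sum_(i < n) F i s).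
Proof.
move=> cF s; apply: cvg_big => [|i _]; last exact: cF.
by apply: add_continuous.
Qed.

(** * Continuous coding of the point configurations *)

Section config_of_code.
Context (R : realType) (X : ptopologicalType).
Hypothesis cX : compact [set: X].
Hypothesis hX : hausdorff_space X.
Hypothesis sX : @second_countable X.
Variable g : Cantor -> X.
Hypothesis cg : continuous g.
Hypothesis gsurj : forall x, exists c, g c = x.

(** One bit sequence interleaves the codes of infinitely many points: the bits at the positions
    [pickle (i, m)] belong to point [i]. *)
Definition code_point (i : nat) (c : Cantor) : X :=
  g ((fun m => c (pickle (i, m))) : Cantor).

Lemma code_point_continuous i : continuous (code_point i).
Proof.
move=> c; apply: (@continuous_comp _ _ _
  (fun c : Cantor => (fun m => c (pickle (i, m))) : Cantor) g); last exact: cg.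
by apply: Cantor_continuous => n b; exact: Cantor_coord_open.
Qed.

Lemma code_point_surj (x : nat -> X) : exists c, forall i, code_point i c = x i.
Proof.
have /choice[c cx] i := gsurj (x i).
exists (fun n => let p := odflt (0, 0)%N (unpickle n) in c p.1 p.2) => i.
by rewrite -cx /code_point; congr g; apply/funext => m; rewrite pickleK.
Qed.

Definition config_of_code (s : config_code) : srm R X :=
  config R s.1 (fun i => code_point i s.2).

Lemma point_config_of_code (eta : srm R X) :
  point_config R X eta <-> exists s, eta = config_of_code s.
Proof.
rewrite point_configP//; split=> [[k [x ->]]|[s ->]].
  have [c cx] := code_point_surj x; exists (k, c); rewrite /config_of_code/=.
  by congr config; apply/funext => i; rewrite cx.
by exists s.1, (fun i => code_point i s.2).
Qed.

(** The pull-back of a quadratic polynomial to the codes. Pairs with [i = j] are included, since the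
    product measure charges the diagonal. *)
Definition code_quadratic f0 (f1 : X -> R) (f2 : X * X -> R) (s : config_code) : R :=
  f0 + \sum_(i < s.1) f1 (code_point i s.2) +
  \sum_(i < s.1) \sum_(j < s.1) f2 (code_point i s.2, code_point j s.2).

Lemma quadratic_config_of_code f0 f1 f2 s : continuous f1 -> continuous f2 ->
  quadratic f0 f1 f2 (config_of_code s) = code_quadratic f0 f1 f2 s.
Proof.
by move=> c1 c2; rewrite /quadratic /config_of_code pair1_config// pair2_config.
Qed.

Lemma restricted_cubic_config_of_code f0 f1 f2 f3 s :
  continuous f1 -> continuous f2 ->
  restricted_cubic f0 f1 f2 f3 (config_of_code s) =
  code_quadratic f0 f1 f2 s + f3 * s.1%:R ^+ 3.
Proof.
move=> c1 c2; rewrite /restricted_cubic -/(quadratic _ _ _ _).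
by rewrite quadratic_config_of_code// pair3_config.
Qed.

Lemma code_quadratic_continuous f0 f1 f2 : continuous f1 -> continuous f2 ->
  continuous (code_quadratic f0 f1 f2).
Proof.
move=> c1 c2; apply: continuous_config_code => k c /=.
apply: cvgD; [apply: cvgD; [exact: cvg_cst|]|].
  apply: (@continuous_sum _ _ k (fun i c => f1 (code_point i c))) => i {}c.
  by apply: continuous_comp; [exact: code_point_continuous|exact: c1].
apply: (@continuous_sum _ _ k (fun i c => \sum_(j < k) f2 (code_point i c, code_point j c))) => i.
apply: (@continuous_sum _ _ k (fun j c => f2 (code_point i c, code_point j c))) => j {}c.
apply: (@continuous_comp _ _ _ (fun c => (code_point i c, code_point j c)) f2).
  by apply: cvg_pair; exact: code_point_continuous.
exact: c2.
Qed.

Lemma config_of_code_continuous : continuous config_of_code.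
Proof.
apply: vague_continuous => f [cf _].
have -> : (fun s => pair1 f (config_of_code s)) = code_quadratic 0 f (cst 0).
  apply/funext => s; rewrite /config_of_code pair1_config// /code_quadratic add0r.
  by rewrite [X in _ = _ + X]big1 ?addr0// => i _; rewrite big1.
exact/code_quadratic_continuous/cst_continuous.
Qed.

Lemma code_quadratic_bound f0 f1 f2 : continuous f1 -> continuous f2 ->
  exists2 C : R, 0 <= C & forall s, `|code_quadratic f0 f1 f2 s| <= C * (1 + s.1%:R ^+ 2).
Proof.
move=> c1 c2; have [M fM] := compact_continuous_bounded cX c1.
have cXX : compact [set: X * X] by rewrite -setXTT; exact: compact_setX.
have [N fN] := compact_continuous_bounded cXX c2.
have M0 : 0 <= M := le_trans (normr_ge0 _) (fM point).
have N0 : 0 <= N := le_trans (normr_ge0 _) (fN (point, point)).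
exists (`|f0| + M + N) => [|s]; first by rewrite !addr_ge0.
have S1 : `|\sum_(i < s.1) f1 (code_point i s.2)| <= s.1%:R * M.
  rewrite (le_trans (ler_norm_sum _ _ _))// mulr_natl -[X in _ *+ X]card_ord -sumr_const.
  by apply: ler_sum => i _; exact: fM.
have S2 : `|\sum_(i < s.1) \sum_(j < s.1) f2 (code_point i s.2, code_point j s.2)|
    <= s.1%:R * (s.1%:R * N).
  rewrite (le_trans (ler_norm_sum _ _ _))// mulr_natl -[X in _ *+ X]card_ord -sumr_const.
  apply: ler_sum => i _; rewrite (le_trans (ler_norm_sum _ _ _))//.
  rewrite mulr_natl -[X in _ *+ X]card_ord -sumr_const.
  by apply: ler_sum => j _; exact: fN.
have k0 : 0 <= s.1%:R :> R by [].
have f00 : 0 <= `|f0| by [].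
rewrite /code_quadratic (le_trans (ler_normD _ _))//.
rewrite (le_trans (lerD (ler_normD _ _) S2))//.
rewrite (le_trans (lerD (lerD (lexx _) S1) (lexx _)))//.
move: M0 N0 k0 f00; move: (s.1%:R) `|f0| => k a M0 N0 k0 a0.
(* The bracket is [1 + k ^ 2 - k], which absorbs the linear term. *)
have : 0 <= M * ((k - 1) ^+ 2 + k) by rewrite mulr_ge0// addr_ge0// sqr_ge0.
have : 0 <= a * k ^+ 2 by rewrite mulr_ge0// sqr_ge0.
rewrite !expr2; nra.
Qed.

(** Configurations with at most [n] points are the continuous image of a compact set of codes, so
    the whole set is sigma-compact in a Hausdorff space. *)
Lemma measurable_point_config :
  measurable (point_config R X : set (borel (srm R X))).
Proof.
have -> : point_config R X =
    \bigcup_n (config_of_code @` [set s | (s.1 <= n)%N]).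
  apply/seteqP; split=> [eta /point_config_of_code[s ->]|eta [n _ [s _ <-]]].
    by exists s.1 => //; exists s => /=.
  by apply/point_config_of_code; exists s.
apply: bigcup_measurable => n _; apply: closed_borel_measurable.
apply: compact_closed; first exact: srm_hausdorff.
apply: continuous_compact; last by case: (compact_clopen_le n).
by apply: continuous_subspaceT; exact: config_of_code_continuous.
Qed.

End config_of_code.

(** * The extended moment functional *)

Section polynomial_space.
Context (R : realType) (X : ptopologicalType).
Hypothesis cX : compact [set: X].
Hypothesis hX : hausdorff_space X.

Lemma Cc_continuous (S : topologicalType) (f : Cc R S) : continuous (\val f).
Proof. by case: (set_mem (valP f)). Qed.

Definition Cc_of (S : topologicalType) (cS : compact [set: S]) (f : S -> R)
    (cf : continuous f) : Cc R S :=
  exist _ f (mem_set (compact_Cc cS cf)).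

Lemma compactXX : compact [set: X * X].
Proof. by rewrite -setXTT; exact: compact_setX. Qed.

Lemma quadratic_lin (c a0 b0 : R) (a1 b1 : X -> R) (a2 b2 : X * X -> R) eta :
  continuous a1 -> continuous b1 -> continuous a2 -> continuous b2 ->
  quadratic (c * a0 + b0) (fun x => c * a1 x + b1 x) (fun x => c * a2 x + b2 x) eta
  = c * quadratic a0 a1 a2 eta + quadratic b0 b1 b2 eta.
Proof.
move=> ca1 cb1 ca2 cb2.
have ma1 := continuous_bounded_measurable cX ca1.
have mb1 := continuous_bounded_measurable cX cb1.
have ma2 := continuous2_bounded_measurable cX hX ca2.
have mb2 := continuous2_bounded_measurable cX hX cb2.
have E1 : pair1 (fun x => c * a1 x + b1 x) eta = c * pair1 a1 eta + pair1 b1 eta.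
  rewrite /pair1 -charge_integralZ// -charge_integralD//.
  exact: bounded_measurableZ.
have E2 : pair2 (fun x => c * a2 x + b2 x) eta = c * pair2 a2 eta + pair2 b2 eta.
  rewrite /pair2 -charge_integralZ// -charge_integralD//.
  exact: bounded_measurableZ.
by rewrite /quadratic E1 E2; ring.
Qed.

Lemma continuous_lin (S : topologicalType) (c : R) (a b : S -> R) :
  continuous a -> continuous b -> continuous (fun x => c * a x + b x).
Proof.
by move=> ca cb x; apply: cvgD; [apply: cvgMr; exact: ca|exact: cb].
Qed.

Definition Cc_lin (S : topologicalType) (cS : compact [set: S]) (c : R)
    (a b : Cc R S) : Cc R S :=
  Cc_of cS (continuous_lin (c := c) (@Cc_continuous S a) (@Cc_continuous S b)).

Variable L : P2 R X -> R.
Hypothesis linL : P2_linear L.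

(** Linearity of [L] is a statement about functions in [P2]; this is its form on coefficients, in
    which the majorants below are given. *)
Lemma P2_quadratic_lin c a0 b0 (a1 b1 : Cc R X) (a2 b2 : Cc R (X * X)%type) :
  L (P2_quadratic (c * a0 + b0) (Cc_lin cX c a1 b1) (Cc_lin compactXX c a2 b2)) =
  c * L (P2_quadratic a0 a1 a2) + L (P2_quadratic b0 b1 b2).
Proof.
apply: linL; apply/funext => eta /=.
by rewrite quadratic_lin//; exact: Cc_continuous.
Qed.

Definition Cc_cst (S : topologicalType) (cS : compact [set: S]) (a : R) : Cc R S :=
  Cc_of cS (@cst_continuous S R a).

Lemma P2_quadratic_cst0 : L (P2_quadratic 0 (Cc_cst cX 0) (Cc_cst compactXX 0)) = 0.
Proof.
have q0 (eta : srm R X) : quadratic 0 (cst 0) (cst 0) eta = 0 :> R.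
  have c1 : continuous (cst 0 : X -> R) by exact: cst_continuous.
  have c2 : continuous (cst 0 : X * X -> R) by exact: cst_continuous.
  have := quadratic_lin 1 0 0 eta c1 c1 c2 c2.
  have z (S : Type) : (fun x : S => 1 * cst 0 x + cst 0 x) = cst 0 :> (S -> R).
    by apply/funext => x; rewrite mulr0 addr0.
  rewrite !z mulr0 addr0; lra.
set b := P2_quadratic _ _ _.
have := @linL (-1) b b b; rewrite mulN1r addNr => -> //.
pose q eta := quadratic 0 (cst 0 : X -> R) (cst 0 : X * X -> R) eta.
by apply/funext => eta; rewrite [LHS]q0 -[RHS]/(-1 * q eta + q eta) /q q0 addr0 mulr0.
Qed.

Variable g : Cantor -> X.
Hypothesis gsurj : forall x, exists c, g c = x.
Hypothesis sX : @second_countable X.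
Variable r : R.
Hypothesis posL : forall (f0 f3 : R) (f1 : Cc R X) (f2 : Cc R (X * X)%type),
  (forall eta : srm R X, point_config R X eta ->
     0 <= restricted_cubic f0 (\val f1) (\val f2) f3 eta) ->
  0 <= L (P2_quadratic f0 f1 f2) + f3 * r.

Definition cubic_weight (s : config_code) : R := 1 + s.1%:R ^+ 3.

Definition cubic_dominated : set (config_code -> R) :=
  [set f | exists C, forall s, `|f s| <= C * cubic_weight s].

Lemma cubic_weight_gt0 s : 0 < cubic_weight s.
Proof. by rewrite ltr_wpDr// exprn_ge0. Qed.

Lemma cubic_dominatedP f : cubic_dominated f ->
  exists2 C, 0 <= C & forall s, `|f s| <= C * cubic_weight s.
Proof.
move=> [C fC]; exists C => //.
have := le_trans (normr_ge0 _) (fC point).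
by rewrite pmulr_lge0// cubic_weight_gt0.
Qed.

Lemma cubic_dominated_space : dominated_space cubic_dominated.
Proof.
split=> [f h [C fC] [D hD]|a f [C fC]|f h [C fC] hf|].
- exists (C + D) => s; rewrite (le_trans (ler_normD _ _))// mulrDl.
  by rewrite lerD.
- by exists (`|a| * C) => s; rewrite normrM -mulrA ler_wpM2l.
- by exists C => s; exact: le_trans (hf s) (fC s).
- by exists 1 => s; rewrite mul1r normr1 lerDl exprn_ge0.
Qed.

(** The values assigned to the restricted cubic polynomials that dominate [f] on the codes, with [r]
    in the role of the third moment. Their infimum is the sublinear function fed to Hahn-Banach. *)
Definition cubic_majorants (f : config_code -> R) : set R :=
  [set y | exists (f0 f3 : R) (f1 : Cc R X) (f2 : Cc R (X * X)%type),
     y = L (P2_quadratic f0 f1 f2) + f3 * r /\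
     forall s, f s <= code_quadratic g f0 (\val f1) (\val f2) s + f3 * s.1%:R ^+ 3].

(** The one place where [posL] enters: as every point configuration has a code, an inequality on the
    codes holds at all configurations. *)
Lemma cubic_majorants_ge0 f y : (forall s, 0 <= f s) -> cubic_majorants f y -> 0 <= y.
Proof.
move=> f0 [a0 [a3 [a1 [a2 [-> fa]]]]]; apply: posL => eta.
move=> /(point_config_of_code hX sX gsurj)[s ->].
have := le_trans (f0 s) (fa s).
by rewrite (restricted_cubic_config_of_code cX hX)//; exact: Cc_continuous.
Qed.

Lemma code_quadratic_lin c a0 b0 (a1 b1 : X -> R) (a2 b2 : X * X -> R) s :
  code_quadratic g (c * a0 + b0) (fun x => c * a1 x + b1 x)
    (fun x => c * a2 x + b2 x) s =
  c * code_quadratic g a0 a1 a2 s + code_quadratic g b0 b1 b2 s.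
Proof.
rewrite /code_quadratic big_split/= -mulr_sumr.
under [X in _ + X = _]eq_bigr do rewrite big_split/= -mulr_sumr.
by rewrite big_split/= -mulr_sumr; ring.
Qed.

Lemma cubic_majorants_lin c f h y z : 0 <= c -> cubic_majorants f y ->
  cubic_majorants h z -> cubic_majorants (fun s => c * f s + h s) (c * y + z).
Proof.
move=> c0 [a0 [a3 [a1 [a2 [-> fa]]]]] [b0 [b3 [b1 [b2 [-> hb]]]]].
exists (c * a0 + b0), (c * a3 + b3), (Cc_lin cX c a1 b1), (Cc_lin compactXX c a2 b2).
split; first by rewrite P2_quadratic_lin; ring.
move=> s; rewrite code_quadratic_lin.
have := lerD (ler_wpM2l c0 (fa s)) (hb s).
by move=> /le_trans; apply; rewrite mulrDl mulrDr mulrA addrACA.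
Qed.

(** The weight is itself a restricted cubic polynomial, with [f0 = f3 = C]; this gives every
    dominated function a majorant and bounds its majorants from below. *)
Lemma cubic_majorants_weight C : cubic_majorants (fun s => C * cubic_weight s)
  (C * (L (P2_quadratic 1 (Cc_cst cX 0) (Cc_cst compactXX 0)) + r)).
Proof.
exists C, C, (Cc_lin cX C (Cc_cst cX 0) (Cc_cst cX 0)),
  (Cc_lin compactXX C (Cc_cst compactXX 0) (Cc_cst compactXX 0)); split.
  have := P2_quadratic_lin C 1 0 (Cc_cst cX 0) (Cc_cst cX 0)
     (Cc_cst compactXX 0) (Cc_cst compactXX 0).
  by rewrite mulr1 addr0 P2_quadratic_cst0 addr0 mulrDr => ->.
move=> s; rewrite /code_quadratic /= mulr0 addr0 !big1_eq.
by rewrite !addr0 /cubic_weight mulrDr mulr1.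
Qed.

Lemma cubic_functional : exists2 Lam : (config_code -> R) -> R,
  positive_functional cubic_dominated Lam &
  forall f y, cubic_dominated f -> cubic_majorants f y -> Lam f <= y.
Proof.
pose p f := inf (cubic_majorants f).
pose c0 := L (P2_quadratic 1 (Cc_cst cX 0) (Cc_cst compactXX 0)) + r.
(* If [C * cubic_weight] dominates the absolute value of [f], adding it to [f] gives a nonnegative
   function, whose majorants have nonnegative values. *)
have lb f : cubic_dominated f -> has_lbound (cubic_majorants f).
  move=> /cubic_dominatedP[C C0 fC]; exists (- (C * c0)) => y fy.
  have := cubic_majorants_lin ler01 fy (cubic_majorants_weight C).
  move=> /cubic_majorants_ge0; rewrite mul1r => H.
  rewrite -subr_ge0 opprK; apply: H => s; rewrite mul1r.
  by have := fC s; rewrite ler_norml => /andP[+ _]; rewrite -subr_ge0 opprK.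
have ne f : cubic_dominated f -> cubic_majorants f !=set0.
  move=> /cubic_dominatedP[C C0 fC]; exists (C * c0).
  have [a0 [a3 [a1 [a2 [E fa]]]]] := cubic_majorants_weight C.
  exists a0, a3, a1, a2; split => // s.
  by rewrite (le_trans (ler_norm _))// (le_trans (fC s)).
have ple f y : cubic_dominated f -> cubic_majorants f y -> p f <= y.
  by move=> /lb fl fy; apply: ge_inf.
have [dD dZ _ _] := cubic_dominated_space.
have p0 f y : cubic_dominated f -> (forall z, cubic_majorants f z -> y <= z) -> y <= p f.
  by move=> /ne f0 yz; apply: lb_le_inf.
have m0 : cubic_majorants (cst 0) 0.
  by have := cubic_majorants_weight 0; rewrite mul0r; congr cubic_majorants;
    apply/funext => s; rewrite mul0r.
have mE f h : f = h -> cubic_majorants f = cubic_majorants h by move=> ->.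
have ps : sublinear_on cubic_dominated p.
  split=> [f h Df Dh|a f a0 Df].
    rewrite -lerBlDr; apply: (@p0) => // y fy; rewrite lerBlDr [leRHS]addrC -lerBlDr.
    apply: (@p0) => // z hz; rewrite lerBlDr; apply: (@ple); first exact: dD.
    have := cubic_majorants_lin ler01 hz fy; rewrite mul1r.
    rewrite (mE _ (f + h))//; apply/funext => s; rewrite mul1r addrC//.
  rewrite -ler_pdivrMl//; apply: (@p0) => // y fy; rewrite ler_pdivrMl//.
  apply: (@ple); first exact: dZ.
  have := cubic_majorants_lin (ltW a0) fy m0; rewrite addr0.
  by rewrite (mE _ (a *: f))//; apply/funext => s; rewrite addr0.
have d0 : cubic_dominated 0 by exists 0 => s; rewrite normr0 mul0r.
have [Lam [LD LZ Lp]] := hahn_banach_on d0 dD dZ ps.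
exists Lam; last by move=> f y Df fy; exact: le_trans (Lp f Df) (ple _ _ Df fy).
split=> // f Df f0; rewrite -oppr_le0 -mulN1r -LZ//.
apply: (le_trans (Lp _ (dZ _ _ Df))); apply: (@ple); first exact: dZ.
(* For nonnegative [f], a majorant of [0] with value [0] is also a majorant of [- f], so [Lam] is
   nonpositive on [- f]. *)
have [a0 [a3 [a1 [a2 [E fa]]]]] := m0.
exists a0, a3, a1, a2; split => // s; rewrite (le_trans _ (fa s))//=.
by rewrite mulN1r oppr_le0.
Qed.

Lemma subcubic_dominated (f : config_code -> R) C :
  (forall s, `|f s| <= C * (1 + s.1%:R ^+ 2)) -> cubic_dominated f.
Proof.
move=> fC; have C0 : 0 <= C.
  by have := le_trans (normr_ge0 _) (fC (0%N, point)); rewrite expr0n/= addr0 mulr1.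
exists (2 * C) => s; rewrite (le_trans (fC s))// /cubic_weight.
case: s => [[|k] c] /=; first by rewrite !expr0n/= !addr0; lra.
have : 1 <= k.+1%:R :> R by rewrite ler1n.
move: (k.+1%:R : R) => x x1.
have x2 : x ^+ 2 <= x ^+ 3 by rewrite ler_weXn2l.
have : 0 <= C * (1 + 2 * x ^+ 3 - x ^+ 2).
  by rewrite mulr_ge0//; have := exprn_ge0 3 (le_trans ler01 x1); lra.
by rewrite !mulrDr; lra.
Qed.

Lemma code_quadratic_dominated f0 f1 f2 : continuous f1 -> continuous f2 ->
  cubic_dominated (code_quadratic g f0 f1 f2).
Proof.
move=> c1 c2; have [C C0 fC] := code_quadratic_bound cX g f0 c1 c2.
exact: (@subcubic_dominated _ C).
Qed.

(** A quadratic polynomial and its opposite are their own majorants, with [f3 = 0]; the two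
    resulting inequalities give equality. *)
Lemma functional_quadratic (Lam : (config_code -> R) -> R) f0 (f1 : Cc R X)
    (f2 : Cc R (X * X)%type) :
  positive_functional cubic_dominated Lam ->
  (forall f y, cubic_dominated f -> cubic_majorants f y -> Lam f <= y) ->
  Lam (code_quadratic g f0 (\val f1) (\val f2)) = L (P2_quadratic f0 f1 f2).
Proof.
move=> Lpos Lle; set q := code_quadratic _ _ _ _.
have Dq : cubic_dominated q by apply: code_quadratic_dominated; exact: Cc_continuous.
apply/eqP; rewrite eq_le; apply/andP; split.
  apply: Lle => //; exists f0, 0, f1, f2; split; first by rewrite mul0r addr0.
  by move=> s; rewrite mul0r addr0.
rewrite -lerN2 -mulN1r -(pfunZ Lpos)//.
apply: Lle; first exact: (dspZ cubic_dominated_space).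
exists (-1 * f0 + 0), 0, (Cc_lin cX (-1) f1 (Cc_cst cX 0)),
  (Cc_lin compactXX (-1) f2 (Cc_cst compactXX 0)); split.
  by rewrite P2_quadratic_lin P2_quadratic_cst0 mul0r !addr0 mulN1r.
move=> s; rewrite code_quadratic_lin mul0r addr0 lerDl.
rewrite /code_quadratic add0r big1// add0r big1// => i _; exact: big1.
Qed.

End polynomial_space.

(** * No mass is lost for functions of quadratic growth *)

Section subcubic_integral.
Context (R : realType) (Lam : (config_code -> R) -> R).
Hypothesis Lpos : positive_functional (@cubic_dominated R) Lam.
Variable W : nat -> set config_code.
Hypothesis Wclopen : forall n, compact_clopen (W n).
Hypothesis Wbase : forall x U, nbhs x U -> exists2 n, W n x & W n `<=` U.
Variable nu : {measure set (borel config_code) -> \bar R}.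
Hypothesis nuE : forall A : set config_code, compact_clopen A ->
  nu A = (Lam \1_A)%:E.

Let Edom := @cubic_dominated_space R.

(* Above [s.1 = n] a quadratic growth is at most [2 / n] times a cubic one. *)
Lemma subcubic_tail (f : config_code -> R) C (e : R) :
  (forall s, 0 <= f s) -> (forall s, f s <= C * (1 + s.1%:R ^+ 2)) -> 0 < e ->
  exists2 A : set config_code, compact_clopen A &
    Lam (fun s => f s * \1_(~` A) s) <= e.
Proof.
move=> f0 fC e0; have Df : cubic_dominated f.
  by apply: (@subcubic_dominated R f C) => s; rewrite ger0_norm.
have C0 : 0 <= C.
  by have := le_trans (f0 _) (fC (0%N, point)); rewrite expr0n/= addr0 mulr1.
have Dw : cubic_dominated (@cubic_weight R).
  by exists 1 => s; rewrite mul1r ger0_norm// ltW// cubic_weight_gt0.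
have w0 : 0 <= Lam (@cubic_weight R).
  by apply: (pfun_ge0 Lpos) => // s; rewrite ltW// cubic_weight_gt0.
(* Beyond [n] points the tail is at most [2 * C / n] times the value of [Lam] on the weight, which
   is at most [e] once [n] exceeds [K]. *)
pose K := 2 * C * Lam (@cubic_weight R) / e.
have K0 : 0 <= K by rewrite divr_ge0 ?mulr_ge0// ltW.
pose n := Num.bound K.
have Kn : K < n%:R by exact: archi_boundP.
have n0 : 0 < n%:R :> R := le_lt_trans K0 Kn.
exists [set s | (s.1 <= n)%N]; first exact: compact_clopen_le.
have -> : e = K / n%:R * e + (e - K / n%:R * e) by rewrite addrC subrK.
have Kne : K / n%:R * e <= e by rewrite ler_piMl ?ltW// ltr_pdivrMr// mul1r.
rewrite (@le_trans _ _ (K / n%:R * e))//; last by rewrite lerDl subr_ge0.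
have -> : K / n%:R * e = (2 * C / n%:R) * Lam (@cubic_weight R).
  by rewrite /K; field; rewrite !gt_eqF.
rewrite -(pfunZ Lpos)//; apply: (pfun_le Edom Lpos).
- exact: dsp_restrict.
- exact: (dspZ Edom).
move=> s; rewrite indicE in_setC.
case: (boolP (s \in _)) => [_|/negP sn] /=.
  by rewrite mulr0 mulr_ge0 ?divr_ge0 ?mulr_ge0// ltW// cubic_weight_gt0.
rewrite mulr1 (le_trans (fC s))//.
have {sn} : (n < s.1)%N by rewrite ltnNge; apply/negP => ns; apply: sn; rewrite inE.
rewrite -(ltr_nat R) /cubic_weight; move: (s.1%:R : R) => k nk.
rewrite mulrAC ler_pdivlMr//.
have k0 : 0 < k := lt_trans n0 nk.
have kn : (1 + k ^+ 2) * n%:R <= (1 + k ^+ 2) * k.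
  by apply: ler_wpM2l; [rewrite addr_ge0// exprn_ge0// ltW|exact: ltW].
(* Equivalent to [(1 + k ^ 2) * k <= 2 * (1 + k ^ 3)], the origin of the factor [2]. *)
have k1 : k <= 2 + k ^+ 3.
  have : 0 <= k * (k - 1) ^+ 2 by apply: mulr_ge0; [exact: ltW|exact: sqr_ge0].
  have : 0 <= (k - 1) ^+ 2 by exact: sqr_ge0.
  rewrite !expr2 !exprS expr0; nra.
have : C * ((1 + k ^+ 2) * n%:R) <= C * (2 * (1 + k ^+ 3)).
  rewrite ler_wpM2l// (le_trans kn)//.
  by move: k1; rewrite mulrDl mul1r -exprSr; lra.
by rewrite !mulrA [C * 2]mulrC.
Qed.

(** A function of arbitrary sign is written [(f + w) - w] with [w] its quadratic bound; both terms
    are nonnegative, continuous and at most [2 * w]. *)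
Lemma subcubic_integral (f : config_code -> R) C : continuous f ->
  (forall s, `|f s| <= C * (1 + s.1%:R ^+ 2)) ->
  nu.-integrable setT (EFin \o f) /\ (\int[nu]_s (f s)%:E = (Lam f)%:E)%E.
Proof.
move=> cf fC; pose w (s : config_code) : R := C * (1 + s.1%:R ^+ 2).
have w0 s : 0 <= w s by exact: le_trans (fC s).
have cw : continuous w.
  apply: continuous_config_code => k c; rewrite /w /=.
  exact: (@cst_continuous Cantor R (C * (1 + k%:R ^+ 2)) c).
have int (h : config_code -> R) : continuous h -> (forall s, 0 <= h s) ->
    (forall s, h s <= 2 * C * (1 + s.1%:R ^+ 2)) ->
    nu.-integrable setT (EFin \o h) /\ (\int[nu]_s (h s)%:E = (Lam h)%:E)%E.
  move=> ch h0 hC.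
  have Dh : cubic_dominated h.
    by apply: (@subcubic_dominated R h (2 * C)) => s; rewrite ger0_norm.
  have E : (\int[nu]_s (h s)%:E = (Lam h)%:E)%E.
    apply: (@integral_functional R _ _ Lam Edom Lpos W) => // e e0.
    exact: (@subcubic_tail h (2 * C)).
  split => //; apply/integrableP; split.
    by apply/measurable_EFinP; exact: continuous_borel_measurableR.
  under eq_integral do rewrite /= ger0_norm//.
  by rewrite E ltry.
have [ifw Efw] : nu.-integrable setT (EFin \o (f \+ w)) /\
    (\int[nu]_s ((f \+ w) s)%:E = (Lam (f \+ w))%:E)%E.
  apply: int => [s|s|s].
  - by apply: cvgD; [exact: cf|exact: cw].
  - by have := fC s; rewrite ler_norml => /andP[+ _]; rewrite /w /=; lra.
  - by have := le_trans (ler_norm _) (fC s); rewrite /w /=; lra.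
have [iw Ew] : nu.-integrable setT (EFin \o w) /\ (\int[nu]_s (w s)%:E = (Lam w)%:E)%E.
  by apply: int => // s; have := w0 s; rewrite /w; lra.
have Df : cubic_dominated f by exact: (@subcubic_dominated R f C).
have Dw : cubic_dominated w.
  by apply: (@subcubic_dominated R w C) => s; rewrite ger0_norm.
have fE : EFin \o f = ((EFin \o (f \+ w)%R) \- (EFin \o w))%E.
  by apply/funext => s /=; rewrite -EFinB addrK.
have if_ : nu.-integrable setT (EFin \o f) by rewrite fE; exact: integrableB.
split => //; rewrite -[LHS]/(integral nu setT (EFin \o f)) fE integralB//.
by rewrite Efw Ew -EFinB (pfunD Lpos)// addrK.
Qed.

End subcubic_integral.

(** * The two implications *)

Section truncated_moment_problem.
Context (R : realType) (X : ptopologicalType).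
Hypothesis cX : compact [set: X].
Hypothesis hX : hausdorff_space X.
Hypothesis sX : @second_countable X.
Variable L : P2 R X -> R.
Hypothesis linL : P2_linear L.

Lemma P2_val (b : P2 R X) : exists (f0 : R) (f1 : Cc R X) (f2 : Cc R (X * X)%type),
  b = P2_quadratic f0 f1 f2.
Proof.
have [f0 [f1 [f2 bE]]] := set_mem (valP b).
by exists f0, f1, f2; exact: val_inj.
Qed.

Lemma compact_measurable (A : set (srm R X)) : compact A ->
  measurable (A : set (borel (srm R X))).
Proof.
move=> kA; apply: closed_borel_measurable; apply: compact_closed => //.
exact: srm_hausdorff.
Qed.

Lemma pair3_point_config_ge0 (eta : srm R X) : point_config R X eta ->
  0 <= pair3 (cst 1) eta.
Proof.
by move=> /(point_configP hX sX)[k [x ->]]; rewrite pair3_config// exprn_ge0.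
Qed.

Lemma pair3_measurable : measurable_fun setT (pair3 (cst 1) : borel (srm R X) -> R).
Proof.
rewrite (_ : pair3 _ = fun eta => pair1 (cst 1) eta ^+ 3); last first.
  by apply/funext => eta; exact: pair3_cst1.
apply: measurable_funX; apply: (pair1_measurable cX); exact: cst_continuous.
Qed.

Lemma cubic_lead_ge0 f0 f1 f2 (f3 : R) : continuous f1 -> continuous f2 ->
  (forall eta : srm R X, point_config R X eta ->
     0 <= restricted_cubic f0 f1 f2 f3 eta) -> 0 <= f3.
Proof.
move=> c1 c2 q0; have [g cg gsurj] := Cantor_surjection cX hX sX.
have [C C0 fC] := code_quadratic_bound cX g f0 c1 c2.
rewrite leNgt; apply/negP => f30.
(* With [f3] negative, [n] copies of a single point give a contradiction: [n >= 1] and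
   [2 * C < - f3 * n] yield [C * (1 + n ^ 2) <= 2 * C * n ^ 2 < - f3 * n ^ 3]. *)
pose n := (Num.bound (2 * C / - f3)).+1.
have nC : 2 * C < - f3 * n%:R.
  rewrite [ltRHS]mulrC -ltr_pdivrMr ?oppr_gt0// (lt_le_trans (archi_boundP _))//.
    by rewrite divr_ge0 ?mulr_ge0// ltW// oppr_gt0.
  by rewrite ler_nat.
have n1 : 1 <= n%:R :> R by rewrite ler1n.
have := q0 _ (point_config_config R n (fun i => code_point g i point)).
rewrite -/(config_of_code R g (n, point)) (restricted_cubic_config_of_code cX hX)//=.
have := le_trans (ler_norm _) (fC (n, point)) => /=.
move: (code_quadratic _ _ _ _ _) nC n1 => q; move: (n%:R : R) => x nC x1 qC.
have : C * (1 + x ^+ 2) <= C * (2 * x ^+ 2).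
  by apply: ler_wpM2l => //; have := exprn_ege1 2 x1; lra.
have : (2 * C) * x ^+ 2 < (- f3 * x) * x ^+ 2.
  by rewrite ltr_pM2r// exprn_gt0// (lt_le_trans ltr01).
by rewrite !exprS expr0; lra.
Qed.

Lemma moment_bound_of_measure (nu : {measure set (borel (srm R X)) -> \bar R}) :
  representing_measure L nu -> finite_third_moment nu ->
  exists r : R, 0 < r /\
    forall (f0 f3 : R) (f1 : Cc R X) (f2 : Cc R (X * X)%type),
    (forall eta : srm R X, point_config R X eta ->
       0 <= restricted_cubic f0 (\val f1) (\val f2) f3 eta) ->
    0 <= L (P2_quadratic f0 f1 f2) + f3 * r.
Proof.
move=> [_ _ inu Lnu] m3; set N := point_config R X in Lnu *.
have [g cg gsurj] := Cantor_surjection cX hX sX.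
have mN : measurable (N : set (borel (srm R X))).
  exact: (measurable_point_config cX hX sX cg gsurj).
have i3 : nu.-integrable N (EFin \o pair3 (cst 1)).
  apply/integrableP; split.
    by apply/measurable_EFinP; apply: measurable_funTS; exact: pair3_measurable.
  rewrite (eq_integral (EFin \o (pair3 (cst 1) : borel (srm R X) -> R)))// => eta /set_mem Neta /=.
  by rewrite ger0_norm// pair3_point_config_ge0.
pose m := \int[nu]_(eta in N) pair3 (cst 1) eta.
have m0 : 0 <= m by apply: Rintegral_ge0 => eta; exact: pair3_point_config_ge0.
(* The moment [m] may vanish while the bound must be positive; the surplus it creates is [f3], which
   is nonnegative. *)
exists (m + 1); split; first by rewrite ltr_wpDl.
move=> f0 f3 f1 f2 q0.
have f30 : 0 <= f3 by apply: cubic_lead_ge0 q0; exact: Cc_continuous.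
have iq : nu.-integrable N (EFin \o quadratic f0 (\val f1) (\val f2)).
  exact: integrableS (inu (P2_quadratic f0 f1 f2)).
have LE : L (P2_quadratic f0 f1 f2) =
    \int[nu]_(eta in N) quadratic f0 (\val f1) (\val f2) eta.
  by rewrite -[LHS]/(fine (L (P2_quadratic f0 f1 f2))%:E) Lnu.
have if3 : nu.-integrable N (EFin \o (fun eta => f3 * pair3 (cst 1) eta)).
  by have := integrableZl mN f3 i3; congr (_.-integrable _ _).
have : 0 <= \int[nu]_(eta in N)
    (quadratic f0 (\val f1) (\val f2) eta + f3 * pair3 (cst 1) eta).
  by apply: Rintegral_ge0 => eta; exact: q0.
rewrite RintegralD// RintegralZl// -LE mulrDr mulr1 -/m; lra.
Qed.

Lemma measure_of_moment_bound (r : R) :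
  (forall (f0 f3 : R) (f1 : Cc R X) (f2 : Cc R (X * X)%type),
    (forall eta : srm R X, point_config R X eta ->
       0 <= restricted_cubic f0 (\val f1) (\val f2) f3 eta) ->
    0 <= L (P2_quadratic f0 f1 f2) + f3 * r) ->
  exists nu : {measure set (borel (srm R X)) -> \bar R},
    representing_measure L nu /\ finite_third_moment nu.
Proof.
move=> posL; have [g cg gsurj] := Cantor_surjection cX hX sX.
have [Lam Lpos Lle] := cubic_functional cX hX linL gsurj sX posL.
have [W Wclopen Wbase] := config_code_base R.
have [nu0 [nu0E nu0fin nu0reg]] :=
  clopen_measure_extension (@cubic_dominated_space R) Lpos Wclopen Wbase.
pose T : borel config_code -> borel (srm R X) := config_of_code R g.
have cT : continuous (config_of_code R g) by exact: config_of_code_continuous.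
have mT : measurable_fun setT T by exact: continuous_borel_measurable.
have mpre (A : set (borel (srm R X))) : measurable A -> measurable (T @^-1` A).
  by move=> mA; rewrite -[X in measurable X]setTI; exact: mT.
pose N := point_config R X.
have mN : measurable (N : set (borel (srm R X))).
  exact: (measurable_point_config cX hX sX cg gsurj).
(* Every code yields a point configuration, so the push-forward is concentrated on [N], and
   integrals over [N] pull back to the whole code space. *)
have NT : T @^-1` N = setT.
  by apply/seteqP; split=> // s _; exact: point_config_config.
have [nu nuE] := pushforward_measure nu0 mT.
have nu_int (D : set (borel (srm R X))) f : measurable D ->
    (\int[nu]_(eta in D) f eta = \int[pushforward nu0 T]_(eta in D) f eta)%E.
  by move=> mD; apply: eq_measure_integral => A mA _; rewrite nuE.
have nuT A : nu A = nu0 (T @^-1` A) by rewrite nuE.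
have code_int f0 (f1 : Cc R X) (f2 : Cc R (X * X)%type) :
    let f := code_quadratic g f0 (\val f1) (\val f2) in
    nu0.-integrable setT (EFin \o f) /\
    (\int[nu0]_s (f s)%:E = (L (P2_quadratic f0 f1 f2))%:E)%E.
  move=> f; have c1 := @Cc_continuous _ _ f1; have c2 := @Cc_continuous _ _ f2.
  have [C C0 fC] := code_quadratic_bound cX g f0 c1 c2.
  rewrite -(functional_quadratic cX hX linL f0 f1 f2 Lpos Lle).
  apply: (subcubic_integral Lpos Wclopen Wbase nu0E _ fC).
  exact: code_quadratic_continuous.
have comp f0 (f1 : Cc R X) (f2 : Cc R (X * X)%type) :
    (EFin \o quadratic f0 (\val f1) (\val f2)) \o T =
    EFin \o code_quadratic g f0 (\val f1) (\val f2).
  apply/funext => s /=; congr EFin.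
  by apply: quadratic_config_of_code => //; exact: Cc_continuous.
have mq f0 (f1 : Cc R X) (f2 : Cc R (X * X)%type) :
    measurable_fun setT (EFin \o (quadratic f0 (\val f1) (\val f2)
      : borel (srm R X) -> R)).
  by apply/measurable_EFinP; apply: quadratic_measurable => //; exact: Cc_continuous.
exists nu; split; first split.
- split=> [eta|A mA].
    by exists setT; split; [exact: openT|by []|rewrite nuT preimage_setT].
  have nu_le (K : set (borel (srm R X))) : compact (K : set (srm R X)) ->
      K `<=` A -> (nu K <= nu A)%E.
    by move=> kK KA; rewrite le_measure ?inE//; exact: compact_measurable.
  apply/eqP; rewrite eq_le; apply/andP; split; last first.
    by apply: ge_ereal_sup => _ [K [kK KA] <-]; exact: nu_le.
  apply/lee_addgt0Pr => e e0.
  (* Inner regularity is taken from the code space: the image of a compact [K] inside the preimage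
     of [A] is a compact subset of [A] of at least the mass of [K]. *)
  have [K [kK cK KA nuK]] := outer_regular_inner Wclopen Wbase nu0fin nu0reg (mpre A mA) e0.
  rewrite nuT (le_trans nuK)// leeD2r//.
  have kTK : compact (config_of_code R g @` K).
    by apply: continuous_compact => //; exact: continuous_subspaceT.
  apply: (@le_trans _ _ (nu (config_of_code R g @` K))).
    rewrite nuT le_measure ?inE//.
    + exact: closed_borel_measurable.
    + by apply: mpre; exact: compact_measurable.
    + by move=> s Ks; exists s.
  by apply: ereal_sup_ubound; exists (config_of_code R g @` K) => //; split=> // _ [s /KA ? <-].
- rewrite nuT (_ : T @^-1` _ = set0) ?measure0// -subset0 => s; apply.
  exact: point_config_config.
- move=> b; have [f0 [f1 [f2 ->]]] := P2_val b; have [intf _] := code_int f0 f1 f2.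
  apply/integrableP; split; first exact: mq.
  have mabs : measurable_fun setT (abse \o (EFin \o (quadratic f0 (\val f1) (\val f2)
      : borel (srm R X) -> R))) by exact: measurableT_comp.
  rewrite nu_int// [ltLHS](ge0_integral_pushforward mT nu0 measurableT mabs); last first.
    by move=> eta _; exact: abse_ge0.
  by rewrite -compA comp; move/integrableP : intf => [_].
- move=> b; have [f0 [f1 [f2 ->]]] := P2_val b; have [intf intE] := code_int f0 f1 f2.
  have intT : nu0.-integrable (T @^-1` N)
      ((EFin \o quadratic f0 (\val f1) (\val f2)) \o T) by rewrite NT comp.
  rewrite -intE nu_int// [RHS](integral_pushforward mT (mq f0 f1 f2) intT mN).
  by rewrite NT comp.
- rewrite /finite_third_moment nu_int// ge0_integral_pushforward//; last 2 first.
  + by apply/measurable_EFinP; apply: measurable_funTS; exact: pair3_measurable.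
  + by move=> eta /set_mem Neta; rewrite lee_fin pair3_point_config_ge0.
  rewrite NT.
  have -> : (EFin \o pair3 (cst 1)) \o T = EFin \o (fun s : config_code => s.1%:R ^+ 3).
    by apply/funext => s /=; rewrite pair3_config.
  (* For the cubic growth itself there is no tail estimate; the inequality between integral and
     functional is enough for finiteness. *)
  apply: (le_lt_trans _ (ltry (Lam (fun s => s.1%:R ^+ 3)))).
  apply: (integral_le_functional (@cubic_dominated_space R) Lpos Wclopen Wbase nu0E).
  + by move=> s; rewrite exprn_ge0.
  + by apply: continuous_config_code => k c; exact: (@cst_continuous Cantor R (k%:R ^+ 3) c).
  + by exists 1 => s; rewrite mul1r ger0_norm ?exprn_ge0// /cubic_weight lerDr.
Qed.

End truncated_moment_problem.

Unset Implicit Arguments.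

Theorem theorem3p1 (R : realType) (X : ptopologicalType)
    (cptX : compact [set: X]) (hausX : hausdorff_space X)
    (sndX : @second_countable X)
    (L : P2 R X -> R) (linL : P2_linear L) (posL : config_positive L) :
  (exists nu : {measure set (borel (srm R X)) -> \bar R},
     representing_measure L nu /\ finite_third_moment nu)
  <->
  (exists r : R, 0 < r /\
     forall (f0 f3 : R) (f1 : Cc R X) (f2 : Cc R (X * X)%type),
       (forall eta : srm R X, point_config R X eta ->
          0 <= restricted_cubic f0 (\val f1) (\val f2) f3 eta) ->
       0 <= L (P2_quadratic f0 f1 f2) + f3 * r).
Proof.
split=> [[nu [Lnu nu3]]|[r [_ Lr]]].
  exact: moment_bound_of_measure Lnu nu3.
exact: measure_of_moment_bound Lr.
Qed.
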